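(* In the setting described in the context, let $\theta_v(k)$ and $\hat\theta_v(k)$, $v\in\mathcal V$, be generated by the distributed TD(0) algorithm. With the constant $L>0$ of the context, let $\beta_0$ and $\beta_1$ be the two positive constants $$\beta_0=\mathbb E\big[\|\bar\theta(0)-\theta^*\|^2\big]+\frac{\alpha(0)\,\mathbb E[\|\Theta(0)\|]\,(L+2N\sigma_{\max}R_0)}{N\eta(1-\delta)},\qquad \beta_1=\frac{4L(L+N\sigma_{\max}R_0)}{N\eta(1-\delta)}.$$ 1. If $\alpha(k)=\alpha$ for all $k$, for some positive constant $\alpha$, then for all $v\in\mathcal V$ and all $k$, $$\|\tilde J(\hat\theta_v(k))-\tilde J(\theta^* )\|_D^2\le \frac{\beta_0}{\alpha(1-\gamma)}\,\frac1{k+1}+\frac{\beta_1\alpha}{1-\gamma}.$$ 2. If $\alpha(k)=1/\sqrt{k+1}$ for all $k\ge 0$, then for all $v\in\mathcal V$ and all $k$, $$\|\tilde J(\hat\theta_v(k))-\tilde J(\theta^* )\|_D^2\le \frac{\beta_0+\beta_1(1+\ln(k+1))}{2(1-\gamma)\sqrt{k+1}}.$$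
   Context: **Problem.** There are $N$ agents $\mathcal V=\{1,\dots,N\}$ and a finite state space $\mathcal S=\{1,\dots,n\}$. Under fixed stationary policies of the agents the state evolves as a Markov chain with transition matrix $\mathcal P=(p_{ij})$. The discount factor is $\gamma\in(0,1)$, and agent $v$ has local reward function $\mathcal R_v:\mathcal S\times\mathcal S\to\mathbb R$. Feature vectors $\phi_1,\dots,\phi_K\in\mathbb R^n$ are given; $\phi(i)=(\phi_1(i),\dots,\phi_K(i))^T\in\mathbb R^K$, and $\Phi\in\mathbb R^{n\times K}$ has columns $\phi_\ell$ (rows $\phi(i)^T$). The linear approximation is $\tilde J(\theta)=\Phi\theta$ for $\theta\in\mathbb R^K$. **Communication.** At time $k$ agents communicate over an undirected graph $\mathcal G(k)=(\mathcal V,\mathcal E(k))$, with weight matrix $\mathbf W(k)=[W_{vu}(k)]\in\mathbb R^{N\times N}$. **Standing assumptions.** (A1) There is an integer $\mathcal B$ such that for every positive integer $\ell$ the graph $(\mathcal V,\mathcal E(\ell\mathcal B)\cup\mathcal E(\ell\mathcal B+1)\cup\dots\cup\mathcal E((\ell+1)\mathcal B-1))$ is connected. (A2) There is a constant $\beta>0$ such that $\mathbf W(k)$ is doubly stochastic, $W_{vv}(k)\ge\beta$ for all $v$, and for $u\ne v$, $W_{vu}(k)\in[\beta,1)$ if $(v,u)\in\mathcal E(k)$ and $W_{vu}(k)=0$ otherwise. (A3) The Markov chain with transition matrix $\mathcal P$ is irreducible; $\pi$ is its unique stationary distribution (positive entries), $D=\mathrm{diag}(\pi(1),\dots,\pi(n))$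 and $\|J\|_D^2=J^TDJ$. (A4) There are constants $C_v$ with $|\mathcal R_v(s,s')|\le C_v$ for all $s,s'\in\mathcal S$, $v\in\mathcal V$. (A5) The $\phi_\ell$ are linearly independent, i.e. $\Phi$ has full column rank, and $\|\phi(s)\|\le1$ for all $s\in\mathcal S$. (A6) $\mathcal X\subset\mathbb R^K$ is convex and compact and contains $\theta^*$ (defined below). (Sampling) The data tuples $(s(k),s'(k),r_v(k))$ are sampled i.i.d. over $k$ from the stationary distribution: $s(k)\sim\pi$, $s'(k)$ given $s(k)=i$ has distribution $p_{i\cdot}$, and $r_v(k)=\mathcal R_v(s(k),s'(k))$. **Matrices and optimal weight.** $\mathbf A=\mathbb E_\pi[\phi(s)(\phi(s)-\gamma\phi(s'))^T]$ and $b_v=\mathbb E_\pi[r_v\phi(s)]$, where $(s,s',r_v)$ is distributed as one data tuple. $\mathbf A$ is positive definite ($x^T\mathbf Ax>0$ for $x\ne0$). $\theta^*$ is the unique solution of the projected Bellman equation $\Pi\,\mathcal T(\Phi\theta^* )=\Phi\theta^*$, where $(\mathcal TJ)(i)=\sum_{j}p_{ij}\{\frac1N\sum_{v}\mathcal R_v(i,j)+\gamma J(j)\}$ and $\Pi$ is the $\|\cdot\|_D$-projection onto $\mathrm{span}\{\phi_\ell\}$; it satisfies $\mathbf A\theta^*=\frac1N\sum_{v\in\mathcal V}b_v$. $\sigma_{\min},\sigma_{\max}$ are the smallest and largest singular values of $\mathbf A$, and $R_0=\max_{\theta\in\mathcal X}\|\theta-\theta^*\|$. **Algorithm (distributed TD(0)).**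 Each agent $v$ picks an arbitrary $\theta_v(0)\in\mathcal X$; set $\hat\theta_v(0)=\theta_v(0)$, $S_v(0)=0$. Given stepsizes $\{\alpha(k)\}$, for $k=0,1,\dots$: $$y_v(k)=\sum_{u\in\mathcal V}W_{vu}(k)\theta_u(k),\quad d_v(k)=r_v(k)+\theta_v(k)^T(\gamma\phi(s'(k))-\phi(s(k))),$$ $$\theta_v(k+1)=[\,y_v(k)+\alpha(k)d_v(k)\phi(s(k))\,]_{\mathcal X},$$ $$S_v(k+1)=S_v(k)+\alpha(k),\qquad \hat\theta_v(k+1)=\frac{S_v(k)\hat\theta_v(k)+\alpha(k)\theta_v(k)}{S_v(k+1)},$$ where $[\cdot]_{\mathcal X}$ is the projection onto $\mathcal X$. **Notation.** $\|\cdot\|$ is the Euclidean norm for vectors and the Frobenius norm for matrices. $\Theta(k)\in\mathbb R^{N\times K}$ has rows $\theta_v(k)^T$, $\bar\theta(k)=\frac1N\sum_v\theta_v(k)$, $\mathbf Q=\mathbf I-\frac1N\mathbf 1\mathbf 1^T$ with $\mathbf 1\in\mathbb R^N$ the all-ones vector. With $\sigma_2(\mathbf W(k))$ the second largest singular value of $\mathbf W(k)$, $$\eta=\min\{1-1/(2N^3),\ \sup_{k\ge0}\sigma_2(\mathbf W(k))\}\in(0,1),\qquad \delta=\eta^{1/\mathcal B}.$$ The following consequence of (A1)–(A2), recalled from the literature, is used: $\|\mathbf W(k)\cdots\mathbf W(k+\mathcal B-1)\mathbf Q\Theta\|\le\eta\|\mathbf Q\Theta\|$ for all $\Theta\in\mathbb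 R^{N\times K}$. **Constant $L$.** Let $h_v(k)=b_v-\mathbf A\theta_v(k)$ and $M_v(k)=d_v(k)\phi(s(k))-h_v(k)$. By (A4)–(A6) there are constants $L_v>0$ with $\|h_v(k)\|+\|M_v(k)\|\le L_v$ for all $k$; $L=\sum_{v\in\mathcal V}L_v$.
   Formalization: The bounds are proved for the expectation of the left-hand sides (pathwise they can fail), and the recalled contraction is taken for W(k+B−1)⋯W(k), the product order of the dynamics, instead of W(k)⋯W(k+B−1); for symmetric weights these are equivalent. *)

(* Defs.v *)
From HB Require Import structures.
From mathcomp Require Import all_boot all_order all_algebra.
From mathcomp Require Import polyrcf.
From mathcomp Require Import all_classical all_reals all_analysis.

Set Implicit Arguments.
Unset Strict Implicit.
Unset Printing Implicit Defensive.

Import Order.TTheory GRing.Theory Num.Theory.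
Local Open Scope classical_set_scope.
Local Open Scope ring_scope.

Section Norms.
Variable R : realType.

(* Euclidean norm on column vectors, Frobenius norm on matrices (the library
   norm [`|A|] on matrices is the sup norm). *)
Definition enorm m n (A : 'M[R]_(m, n)) : R :=
  Num.sqrt (\sum_i \sum_j A i j ^+ 2).

Definition sqnormD n (pi : 'rV[R]_n) (J : 'cV[R]_n) : R :=
  (J^T *m diag_mx pi *m J) 0 0.

Definition normD n (pi : 'rV[R]_n) (J : 'cV[R]_n) : R :=
  Num.sqrt (sqnormD pi J).

(* A point of [C] nearest to [y] for the norm [nrm]. *)
Definition proj_on m (nrm : 'cV[R]_m -> R) (C : set 'cV[R]_m) (y : 'cV[R]_m) :
    'cV[R]_m :=
  xget 0 [set z | C z /\ forall x, C x -> nrm (y - z) <= nrm (y - x)].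

(* Singular values with multiplicity, in nonincreasing order: the square roots
   of the eigenvalues of [A^T *m A], each repeated according to its
   multiplicity in the characteristic polynomial. *)
Definition singular_values m n (A : 'M[R]_(m, n)) : seq R :=
  let p := char_poly (A^T *m A) in
  rev [seq Num.sqrt x | x <- flatten [seq nseq (mup x p) x | x <- rootsR p]].

(* Default value 0 when there are fewer than one, resp. two, singular values. *)
Definition sigma_max m n (A : 'M[R]_(m, n)) : R := (singular_values A)`_0.
Definition sigma2 m n (A : 'M[R]_(m, n)) : R := (singular_values A)`_1.

End Norms.

Section Chain.
Variables (R : realType) (n : nat).

Definition stochastic (P : 'M[R]_n) : Prop :=
  (forall i j, 0 <= P i j) /\ (forall i, \sum_j P i j = 1).

Definition doubly_stochastic (P : 'M[R]_n) : Prop :=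
  stochastic P /\ stochastic P^T.

Definition irreducible (P : 'M[R]_n) : Prop :=
  forall i j, exists m : nat, 0 < (P ^+ m) i j.

Definition stationary (P : 'M[R]_n) (pi : 'rV[R]_n) : Prop :=
  [/\ forall i, 0 <= pi 0 i, \sum_i pi 0 i = 1 & pi *m P = pi].

(* Expectation of [F s s'] for [s] of law [pi] and [s'] of law [P s] given [s]. *)
Definition Epi (pi : 'rV[R]_n) (P : 'M[R]_n) (m p : nat)
    (F : 'I_n -> 'I_n -> 'M[R]_(m, p)) : 'M[R]_(m, p) :=
  \sum_i \sum_j (pi 0 i * P i j) *: F i j.

End Chain.

Section Features.
Variables (R : realType) (N n K : nat).
Variables (P : 'M[R]_n) (pi : 'rV[R]_n) (gamma : R).
Variables (Rw : 'I_N -> 'I_n -> 'I_n -> R) (Phi : 'M[R]_(n, K)).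

Definition phi (i : 'I_n) : 'cV[R]_K := (row i Phi)^T.

Definition Jtilde (theta : 'cV[R]_K) : 'cV[R]_n := Phi *m theta.

Definition Amat : 'M[R]_K :=
  Epi pi P (fun i j => phi i *m (phi i - gamma *: phi j)^T).

Definition bvec (v : 'I_N) : 'cV[R]_K :=
  Epi pi P (fun i j => Rw v i j *: phi i).

Definition bellman (J : 'cV[R]_n) : 'cV[R]_n :=
  \col_i \sum_j P i j * (N%:R^-1 * (\sum_v Rw v i j) + gamma * J j 0).

Definition projected_bellman_solution (theta : 'cV[R]_K) : Prop :=
  proj_on (normD pi) (range Jtilde) (bellman (Jtilde theta)) = Jtilde theta.

End Features.

Section Algorithm.
Variables (R : realType) (N n K : nat).
Variables (gamma : R) (Rw : 'I_N -> 'I_n -> 'I_n -> R) (Phi : 'M[R]_(n, K)).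
Variables (X : set 'cV[R]_K) (W : nat -> 'M[R]_N) (alpha : nat -> R).
(* One realisation of the initial values and of the samples. *)
Variables (theta0 : 'I_N -> 'cV[R]_K) (s s' : nat -> 'I_n).

Definition td_error (v : 'I_N) (theta : 'cV[R]_K) (i j : 'I_n) : R :=
  Rw v i j + (theta^T *m (gamma *: phi Phi j - phi Phi i)) 0 0.

Fixpoint td_iter (k : nat) : 'I_N -> 'cV[R]_K :=
  if k is k'.+1 then fun v =>
    proj_on (@enorm R K 1) X
      (\sum_u W k' v u *: td_iter k' u
       + (alpha k' * td_error v (td_iter k' v) (s k') (s' k'))
           *: phi Phi (s k'))
  else theta0.

Fixpoint td_weight (k : nat) : R :=
  if k is k'.+1 then td_weight k' + alpha k' else 0.

Fixpoint td_avg (k : nat) : 'I_N -> 'cV[R]_K :=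
  if k is k'.+1 then fun v =>
    (td_weight k'.+1)^-1 *: (td_weight k' *: td_avg k' v
                             + alpha k' *: td_iter k' v)
  else theta0.

End Algorithm.

Section Noise.
Variables (R : realType) (N n K : nat).
Variables (P : 'M[R]_n) (pi : 'rV[R]_n) (gamma : R).
Variables (Rw : 'I_N -> 'I_n -> 'I_n -> R) (Phi : 'M[R]_(n, K)).

Definition td_mean (v : 'I_N) (theta : 'cV[R]_K) : 'cV[R]_K :=
  bvec P pi Rw Phi v - Amat P pi gamma Phi *m theta.

Definition td_noise (v : 'I_N) (theta : 'cV[R]_K) (i j : 'I_n) : 'cV[R]_K :=
  td_error gamma Rw Phi v theta i j *: phi Phi i - td_mean v theta.

End Noise.

Section Network.
Variables (R : realType) (N : nat).

Definition mean_vec K (theta : 'I_N -> 'cV[R]_K) : 'cV[R]_K :=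
  N%:R^-1 *: \sum_v theta v.

Definition stack K (theta : 'I_N -> 'cV[R]_K) : 'M[R]_(N, K) :=
  \matrix_(v, l) theta v l 0.

Definition Qmat : 'M[R]_N := 1%:M - const_mx N%:R^-1.

Definition undirected (E : rel 'I_N) : Prop := symmetric E /\ irreflexive E.

Definition union_connected (E : nat -> rel 'I_N) (B : nat) : Prop :=
  forall l : nat, (0 < l)%N -> forall u v : 'I_N,
    connect (fun x y => [exists t : 'I_B, E (l * B + t)%N x y]) u v.

Definition admissible_weights (E : rel 'I_N) (beta : R) (W : 'M[R]_N) : Prop :=
  [/\ doubly_stochastic W,
      forall v, beta <= W v v
    & forall v u, u != v ->
        (E v u -> beta <= W v u < 1) /\ (~~ E v u -> W v u = 0)].

(* [W (k + m - 1) *m ... *m W k], the matrix that propagates the consensus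
   iteration over the steps [k, ..., k + m - 1]. *)
Fixpoint Wprod (W : nat -> 'M[R]_N) (k m : nat) : 'M[R]_N :=
  if m is m'.+1 then W (k + m')%N *m Wprod W k m' else 1%:M.

Definition mixing_rate (W : nat -> 'M[R]_N) : R :=
  Num.min (1 - (2 * N%:R ^+ 3)^-1) (sup (range (fun k => sigma2 (W k)))).

End Network.

Section Sampling.
Variables (d : measure_display) (T : measurableType d) (R : realType).
Variable Pr : probability T R.

(* Mutual independence of a family of sigma-algebras: the product rule for
   every finite subfamily. *)
Definition mutually_independent (I : choiceType) (F : I -> set (set T)) : Prop :=
  forall (J : seq I) (A : I -> set T), uniq J ->
    (forall j, j \in J -> F j (A j)) ->
    Pr (\bigcap_(j in [set` J]) A j) = (\prod_(j <- J) Pr (A j))%E.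

Definition sigma_vectors (N K : nat) (th : 'I_N -> T -> 'cV[R]_K) :
    set (set T) :=
  <<s [set A | exists v l (Y : set R),
         measurable Y /\ A = [set w | Y (th v w l 0)]] >>.

Definition sigma_sample (n : nat) (s s' : T -> 'I_n) : set (set T) :=
  [set A | exists C : set ('I_n * 'I_n), A = [set w | C (s w, s' w)]].

(* The initial values are random vectors; index [0] carries their sigma-algebra
   and index [k.+1] that of the sample drawn at time [k]. *)
Definition sampling_model (N n K : nat) (P : 'M[R]_n) (pi : 'rV[R]_n)
    (th0 : 'I_N -> T -> 'cV[R]_K) (s s' : nat -> T -> 'I_n) : Prop :=
  [/\ forall v l, measurable_fun setT (fun w => th0 v w l 0),
      forall k i j, measurable [set w | s k w = i /\ s' k w = j],
      forall k i j, Pr [set w | s k w = i /\ s' k w = j] = (pi 0 i * P i j)%:E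
    & mutually_independent (fun k : nat =>
        if k is k'.+1 then sigma_sample (s k') (s' k') else sigma_vectors th0)].

End Sampling.

(* Main.v *)
Require Import Defs.
From HB Require Import structures.
From mathcomp Require Import all_boot all_order all_algebra.
From mathcomp Require Import polyrcf.
From mathcomp Require Import all_classical all_reals all_analysis.
From mathcomp Require Import measurable_realfun.
From mathcomp Require Import ring lra.

Set Implicit Arguments.
Unset Strict Implicit.
Unset Printing Implicit Defensive.

Import Order.TTheory GRing.Theory Num.Theory.
Import numFieldNormedType.Exports.
Local Open Scope classical_set_scope.
Local Open Scope ring_scope.

(** Write [x] for the deviation of the mean parameter from the optimum, [q] for
    the disagreement, that is the Frobenius norm of the centered parameters, and
    [a = x^T A x] for the drift.

    The projected Bellman equation amounts to [A thetastar = mean of the b v],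
    so that the average of the mean directions of the agents is exactly [- A x].
    In one step the mean moves by the average of the sampled directions plus the
    average of the projection errors.  A projection error makes an obtuse angle
    with the direction from any point of the convex set to the projected point
    ([proj_on_obtuse]); it can therefore be charged to the disagreement, and
    with [L / N] bounding the average direction one gets
    [|x'|^2 <= |x|^2 - 2 alpha a + 2 alpha m + 2 alpha (L / N) q
    + (3 / 2) alpha^2 L^2 / N], where [m] is the noise of the sample
    ([deviation_recursion]).  The chain being stationary, [a] dominates
    [(1 - gamma) |Phi x|_D^2] ([Amat_coercive]), and passing from the mean to one
    agent costs at most [2 sigma_max R0 q] ([value_error_le]).  The disagreement
    contracts by [eta] over each block of [B] steps and is fed by moves of size
    [alpha L] ([disagreement_le]).  Summing the recursion, and using convexity
    for the weighted averages of the iterates, bounds the error of the averages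
    along each sample path ([path_sum]).

    The average at time [k] contains only the [k] iterates before time [k],
    whereas the rates are in terms of [k + 1].  For constant steps, [2 k >= k + 1]
    settles the term of the initial distance, [block_rate_average] that of the
    initial disagreement, and the average at time 0 is also the one at time 1
    ([td_avg1]).  For inverse square root steps the sum of the first [k] steps
    dominates [sqrt (k + 1)] from [k = 3] on ([late_rate]); the three smaller
    times use in addition that the drift is at most [(L / N) |x|] ([early_rate],
    [second_rate]).

    Finally the noise has mean zero ([expect_noise]).  Along a fixed finite
    history of samples the parameters are a function of the initial ones, which
    are independent of the history and of the next sample; and the noise is
    centered under the law of one transition ([td_noise_centered]).  The
    parameters are measurable because the projection onto a convex compact set
    is Lipschitz ([measurable_fun_lipschitz]), and bounded because that set is;
    the pathwise bound, which is affine in the initial errors and in the noises,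
    can thus be integrated ([expected_rate]). *)

(** * The Frobenius inner product *)

Section InnerProduct.
Variable R : realType.

Definition dot m n (A B : 'M[R]_(m, n)) : R := \sum_i \sum_j A i j * B i j.

Lemma dotC m n (A B : 'M[R]_(m, n)) : dot A B = dot B A.
Proof. by apply: eq_bigr => i _; apply: eq_bigr => j _; rewrite mulrC. Qed.

Lemma dotDl m n (A B C : 'M[R]_(m, n)) : dot (A + B) C = dot A C + dot B C.
Proof.
rewrite /dot -big_split; apply: eq_bigr => i _.
by rewrite -big_split; apply: eq_bigr => j _; rewrite /= mxE mulrDl.
Qed.

Lemma dotZl m n a (A B : 'M[R]_(m, n)) : dot (a *: A) B = a * dot A B.
Proof.
rewrite /dot mulr_sumr; apply: eq_bigr => i _.
by rewrite mulr_sumr; apply: eq_bigr => j _; rewrite mxE mulrA.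
Qed.

Lemma dotNl m n (A B : 'M[R]_(m, n)) : dot (- A) B = - dot A B.
Proof. by rewrite -scaleN1r dotZl mulN1r. Qed.

Lemma dotBl m n (A B C : 'M[R]_(m, n)) : dot (A - B) C = dot A C - dot B C.
Proof. by rewrite dotDl dotNl. Qed.

Lemma dotDr m n (A B C : 'M[R]_(m, n)) : dot C (A + B) = dot C A + dot C B.
Proof. by rewrite dotC dotDl !(dotC C). Qed.

Lemma dotZr m n a (A B : 'M[R]_(m, n)) : dot B (a *: A) = a * dot B A.
Proof. by rewrite dotC dotZl dotC. Qed.

Lemma dotNr m n (A B : 'M[R]_(m, n)) : dot B (- A) = - dot B A.
Proof. by rewrite dotC dotNl dotC. Qed.

Lemma dotBr m n (A B C : 'M[R]_(m, n)) : dot C (A - B) = dot C A - dot C B.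
Proof. by rewrite dotDr dotNr. Qed.

Lemma dot0l m n (A : 'M[R]_(m, n)) : dot 0 A = 0.
Proof. by rewrite -(scale0r A) dotZl mul0r. Qed.

Lemma dot0r m n (A : 'M[R]_(m, n)) : dot A 0 = 0.
Proof. by rewrite dotC dot0l. Qed.

Lemma dot_suml m n (I : Type) (r : seq I) (Pd : pred I) (F : I -> 'M[R]_(m, n)) B :
  dot (\sum_(i <- r | Pd i) F i) B = \sum_(i <- r | Pd i) dot (F i) B.
Proof.
elim/big_rec2 : _ => [|i x y _ <-]; first by rewrite dot0l.
by rewrite dotDl.
Qed.

Lemma dot_sumr m n (I : Type) (r : seq I) (Pd : pred I) (F : I -> 'M[R]_(m, n)) B :
  dot B (\sum_(i <- r | Pd i) F i) = \sum_(i <- r | Pd i) dot B (F i).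
Proof. by rewrite dotC dot_suml; apply: eq_bigr => i _; rewrite dotC. Qed.

Lemma dot_ge0 m n (A : 'M[R]_(m, n)) : 0 <= dot A A.
Proof. by apply: sumr_ge0 => i _; apply: sumr_ge0 => j _; rewrite -expr2 sqr_ge0. Qed.

Lemma dot_eq0 m n (A : 'M[R]_(m, n)) : dot A A = 0 -> A = 0.
Proof.
move=> /eqP; rewrite psumr_eq0; last first.
  by move=> i _; apply: sumr_ge0 => j _; rewrite -expr2 sqr_ge0.
move=> /allP h; apply/matrixP => i j; rewrite mxE.
have /eqP := h i (mem_index_enum _); move/eqP.
rewrite psumr_eq0; last by move=> k _; rewrite -expr2 sqr_ge0.
by move=> /allP /(_ j (mem_index_enum _)); rewrite /= -expr2 sqrf_eq0 => /eqP.
Qed.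

Lemma dot_trmx m n (A B : 'M[R]_(m, n)) : dot A^T B^T = dot A B.
Proof.
rewrite /dot exchange_big; apply: eq_bigr => i _; apply: eq_bigr => j _.
by rewrite !mxE.
Qed.

Lemma dot_tr m n (A B : 'M[R]_(m, n)) : dot A B = \tr (A^T *m B).
Proof.
rewrite /dot exchange_big; apply: eq_bigr => i _; rewrite mxE.
by apply: eq_bigr => j _; rewrite mxE.
Qed.

Lemma dot_mulmxl m n p (A : 'M[R]_(m, n)) (B : 'M[R]_(n, p)) (C : 'M[R]_(m, p)) :
  dot (A *m B) C = dot B (A^T *m C).
Proof. by rewrite !dot_tr trmx_mul mulmxA. Qed.

Lemma dot_mxE n (x y : 'cV[R]_n) : (x^T *m y) 0 0 = dot x y.
Proof.
by rewrite mxE /dot; apply: eq_bigr => i _; rewrite big_ord1 mxE.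
Qed.

Lemma dot_sqrD m n (A B : 'M[R]_(m, n)) :
  dot (A + B) (A + B) = dot A A + 2 * dot A B + dot B B.
Proof. by rewrite dotDl !dotDr (dotC B A); ring. Qed.

Lemma enormE m n (A : 'M[R]_(m, n)) : enorm A = Num.sqrt (dot A A).
Proof.
by congr Num.sqrt; apply: eq_bigr => i _; apply: eq_bigr => j _; rewrite expr2.
Qed.

Lemma enorm_ge0 m n (A : 'M[R]_(m, n)) : 0 <= enorm A.
Proof. exact: sqrtr_ge0. Qed.

Lemma enorm_sqr m n (A : 'M[R]_(m, n)) : enorm A ^+ 2 = dot A A.
Proof. by rewrite enormE sqr_sqrtr ?dot_ge0. Qed.

Lemma enorm_le m n (A : 'M[R]_(m, n)) c : 0 <= c -> (enorm A <= c) = (dot A A <= c ^+ 2).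
Proof. by move=> c0; rewrite -enorm_sqr ler_sqr ?nnegrE ?enorm_ge0. Qed.

Lemma enorm0 m n : enorm (0 : 'M[R]_(m, n)) = 0.
Proof. by rewrite enormE dot0l sqrtr0. Qed.

Lemma enormZ m n a (A : 'M[R]_(m, n)) : enorm (a *: A) = `|a| * enorm A.
Proof.
by rewrite !enormE dotZl dotZr mulrA -expr2 sqrtrM ?sqr_ge0// sqrtr_sqr.
Qed.

Lemma enormN m n (A : 'M[R]_(m, n)) : enorm (- A) = enorm A.
Proof. by rewrite !enormE dotNl dotNr opprK. Qed.

Lemma enormB m n (A B : 'M[R]_(m, n)) : enorm (A - B) = enorm (B - A).
Proof. by rewrite -enormN opprB. Qed.

(** Cauchy-Schwarz, from the nonnegative square norm of [|B|^2 A - <A,B> B]. *)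
Lemma dot_sqr_le m n (A B : 'M[R]_(m, n)) : dot A B ^+ 2 <= dot A A * dot B B.
Proof.
have [B0|B0] := eqVneq (dot B B) 0.
  by rewrite (dot_eq0 B0) !dot0r mulr0 expr0n.
have Bp : 0 < dot B B by rewrite lt_neqAle eq_sym B0 dot_ge0.
have := dot_ge0 (dot B B *: A - dot A B *: B).
rewrite dotBl !dotBr !dotZl !dotZr (dotC B A).
set a := dot A A; set b := dot B B; set c := dot A B => h.
have : 0 <= b * (a * b - c ^+ 2) by lra.
by rewrite pmulr_rge0// subr_ge0.
Qed.

Lemma dot_le m n (A B : 'M[R]_(m, n)) : dot A B <= enorm A * enorm B.
Proof.
apply: le_trans (ler_norm _) _.
rewrite -(@ler_pXn2r _ 2)// ?nnegrE ?mulr_ge0 ?enorm_ge0//.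
by rewrite exprMn !enorm_sqr real_normK ?num_real// dot_sqr_le.
Qed.

Lemma enormD m n (A B : 'M[R]_(m, n)) : enorm (A + B) <= enorm A + enorm B.
Proof.
rewrite enorm_le ?addr_ge0 ?enorm_ge0// dotDl !dotDr (dotC B A) sqrrD !enorm_sqr.
have := dot_le A B; lra.
Qed.

Lemma enorm_sum m n (I : Type) (r : seq I) (Pd : pred I) (F : I -> 'M[R]_(m, n)) :
  enorm (\sum_(i <- r | Pd i) F i) <= \sum_(i <- r | Pd i) enorm (F i).
Proof.
elim/big_rec2 : _ => [|i x y _ h]; first by rewrite enorm0.
by apply: le_trans (enormD _ _) _; rewrite lerD2l.
Qed.

Lemma coord_le_enorm m n (A : 'M[R]_(m, n)) i j : `|A i j| <= enorm A.
Proof.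
rewrite -(@ler_pXn2r _ 2)// ?nnegrE ?enorm_ge0//.
rewrite enorm_sqr real_normK ?num_real// /dot (bigD1 i)//= (bigD1 j)//= -expr2.
rewrite -addrA lerDl addr_ge0//; first by apply: sumr_ge0 => k _; rewrite -expr2 sqr_ge0.
by apply: sumr_ge0 => k _; apply: sumr_ge0 => l _; rewrite -expr2 sqr_ge0.
Qed.

Lemma dot_row m n (A B : 'M[R]_(m, n)) : dot A B = \sum_i dot (row i A) (row i B).
Proof.
apply: eq_bigr => i _; rewrite /dot big_ord1.
by apply: eq_bigr => j _; rewrite !mxE.
Qed.

Lemma enorm_tr m n (A : 'M[R]_(m, n)) : enorm A^T = enorm A.
Proof. by rewrite !enormE dot_trmx. Qed.

Lemma enorm_row_le m n (A : 'M[R]_(m, n)) i : enorm (row i A) <= enorm A.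
Proof.
rewrite enorm_le ?enorm_ge0// enorm_sqr [leRHS]dot_row (bigD1 i)//= lerDl.
by apply: sumr_ge0 => k _; exact: dot_ge0.
Qed.

(** First-order optimality without calculus: along a line through a minimiser,
    the increase of a quadratic function has the form
    [t ^ 2 * G - 2 * t * b]. *)
Lemma parabola_flat (G b : R) : 0 <= G ->
  (forall t, 0 <= t ^+ 2 * G - 2 * t * b) -> b = 0.
Proof.
move=> G0 h; have G1 : 0 < G + 1 by lra.
have : 0 <= (G + 1) ^+ 2 * ((b / (G + 1)) ^+ 2 * G - 2 * (b / (G + 1)) * b).
  by rewrite mulr_ge0// sqr_ge0.
have -> : (G + 1) ^+ 2 * ((b / (G + 1)) ^+ 2 * G - 2 * (b / (G + 1)) * b) =
  - (b ^+ 2 * (G + 2)) by field; rewrite gt_eqF.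
rewrite oppr_ge0 pmulr_lle0; last by lra.
move=> b2; have : b ^+ 2 == 0 by rewrite eq_le b2 sqr_ge0.
by rewrite sqrf_eq0 => /eqP.
Qed.

Lemma sum_sqr_le (k : nat) (F : 'I_k -> R) : (forall i, 0 <= F i) ->
  \sum_i F i ^+ 2 <= (\sum_i F i) ^+ 2.
Proof.
elim: k F => [|k IH] F F0; first by rewrite !big_ord0 expr0n.
rewrite !big_ord_recl sqrrD.
have := IH (fun i => F (lift ord0 i)) (fun i => F0 _).
have : 0 <= F ord0 * \sum_(i < k) F (lift ord0 i).
  by rewrite mulr_ge0// sumr_ge0.
lra.
Qed.

Lemma enorm_le_sum_row m n (A : 'M[R]_(m, n)) : enorm A <= \sum_i enorm (row i A).
Proof.
rewrite enorm_le; last by apply: sumr_ge0 => i _; exact: enorm_ge0.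
rewrite dot_row; apply: le_trans (sum_sqr_le _); last by move=> i; exact: enorm_ge0.
by apply: ler_sum => i _; rewrite enorm_sqr.
Qed.

End InnerProduct.

(** * Nearest points in compact convex sets *)

Section NearestPoint.
Variable R : realType.

Lemma dot_self_continuous (T : topologicalType) m n (F : T -> 'M[R]_(m, n)) :
  (forall i j, continuous (fun x => F x i j)) ->
  continuous (fun x => dot (F x) (F x)).
Proof.
move=> h.
have addc : continuous (fun x : R * R => x.1 + x.2).
  by move=> x; exact: (@pseudometric_normed_Zmodule.add_continuous R R^o x).
apply: (continuous_big addc) => i _; apply: (continuous_big addc) => j _.
by move=> x; apply: (@cvgM R _ (nbhs x)); exact: h.
Qed.

Lemma dot_dist_continuous m n (y : 'M[R]_(m, n)) :
  continuous (fun x : 'M[R]_(m, n) => dot (y - x) (y - x)).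
Proof.
apply: dot_self_continuous => i j.
have -> : (fun x : 'M[R]_(m, n) => (y - x) i j) = (fun x => y i j - x i j).
  by apply/funext => z; rewrite !mxE.
move=> z; apply: (@cvgB R R^o _ (nbhs z)); first exact: cvg_cst.
exact: coord_continuous.
Qed.

Lemma convex_setE K (X : set 'cV[R]_K) :
  convex_set (X : set (convex_lmodType 'cV[R]_K)) ->
  forall x y t, X x -> X y -> 0 <= t <= 1 -> X (t *: x + (1 - t) *: y).
Proof.
move=> cX x y t Xx Xy t01.
have [t0 t1] := andP t01; pose l := Itv01 t0 t1.
have := cX x y l; rewrite !inE => /(_ Xx Xy).
by [].
Qed.

Lemma convex_set_sum K (X : set 'cV[R]_K) :
  convex_set (X : set (convex_lmodType 'cV[R]_K)) ->
  forall m (w : 'I_m -> R) (x : 'I_m -> 'cV[R]_K),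
    (forall i, 0 <= w i) -> \sum_i w i = 1 -> (forall i, X (x i)) ->
    X (\sum_i w i *: x i).
Proof.
move=> /convex_setE cX; elim=> [|m IH] w x w0 w1 Xx.
  by move: w1; rewrite big_ord0 => /esym/eqP; rewrite oner_eq0.
rewrite big_ord_recl; move: w1; rewrite big_ord_recl => w1.
set S := \sum_(i < m) w (lift ord0 i) in w1.
have S0 : 0 <= S by apply: sumr_ge0.
have [S00|Sn0] := eqVneq S 0.
  have w00 : w ord0 = 1 by rewrite -w1 S00 addr0.
  rewrite w00 scale1r big1 ?addr0// => i _.
  move/eqP: S00; rewrite psumr_eq0// => /allP /(_ i (mem_index_enum _)) /eqP ->.
  by rewrite scale0r.
have -> : \sum_(i < m) w (lift ord0 i) *: x (lift ord0 i) =
    (1 - w ord0) *: \sum_(i < m) (w (lift ord0 i) / S) *: x (lift ord0 i).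
  rewrite -w1 addrC addKr scaler_sumr; apply: eq_bigr => i _.
  by rewrite scalerA mulrCA divff// mulr1.
apply: cX => //; last by rewrite w0 -w1 lerDl.
apply: IH => [i||//]; first by rewrite divr_ge0.
by rewrite -mulr_suml divff.
Qed.

Section Projection.
Variables (K : nat) (X : set 'cV[R]_K).
Hypotheses (cX : convex_set (X : set (convex_lmodType 'cV[R]_K)))
  (kX : compact X) (X0 : X !=set0).

Local Notation proj := (proj_on (@enorm R K 1) X).

Lemma proj_onP y : X (proj y) /\ forall x, X x -> enorm (y - proj y) <= enorm (y - x).
Proof.
apply: (@xgetPex _ 0 [set z | X z /\ forall x, X x -> enorm (y - z) <= enorm (y - x)]).
have [z zX hz] := compact_EVT_min X0 kX (continuous_subspaceT (@dot_dist_continuous _ _ y)).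
exists z; split; first by rewrite inE in zX.
move=> x Xx; rewrite !enormE ler_sqrt ?dot_ge0//.
by apply: hz; rewrite inE.
Qed.

Lemma proj_on_in y : X (proj y). Proof. by case: (proj_onP y). Qed.

(** The variational inequality of the nearest point [z]: moving from [z] to
    [z + t (x - z)], for a small [t > 0], must not bring the point closer to
    [y]. *)
Lemma proj_on_obtuse y x : X x -> dot (y - proj y) (x - proj y) <= 0.
Proof.
move=> Xx; have [zX hz] := proj_onP y; set z := proj y in zX hz *.
pose u := y - z; pose v := x - z; pose D := dot u v; pose b := dot v v.
rewrite -/u -/v -/D.
have h t : 0 <= t <= 1 -> 2 * t * D <= t ^+ 2 * b.
  move=> t01; have := hz _ (convex_setE cX Xx zX t01).
  rewrite enorm_le ?enorm_ge0// enorm_sqr.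
  have -> : y - (t *: x + (1 - t) *: z) = u - t *: v.
    by apply/matrixP => i j; rewrite !mxE; ring.
  rewrite (dot_sqrD u) dotNl !dotNr opprK dotZl !dotZr -/D -/b -/u; lra.
rewrite leNgt; apply/negP => D0.
have b0 : 0 <= b by exact: dot_ge0.
pose t := D / (D + b).
have Db : 0 < D + b by rewrite ltr_pwDl.
have t0 : 0 < t by rewrite divr_gt0.
have t1 : t <= 1 by rewrite ler_pdivrMr// mul1r lerDl.
have := h t; rewrite (ltW t0) t1 => /(_ isT).
rewrite expr2 -mulrA mulrCA -mulrA ler_pM2l//.
have : t * b <= D by rewrite /t mulrAC ler_pdivrMr// ler_pM2l// lerDr ltW.
lra.
Qed.

Lemma proj_on_nonexpansive y1 y2 : enorm (proj y1 - proj y2) <= enorm (y1 - y2).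
Proof.
have h1 := proj_on_obtuse y1 (proj_on_in y2).
have h2 := proj_on_obtuse y2 (proj_on_in y1).
set p := proj y1 in h1 h2 *; set q := proj y2 in h1 h2 *.
have h : dot (p - q) (p - q) <= dot (y1 - y2) (p - q).
  move: h1 h2; rewrite !dotBl !dotBr (dotC q p); lra.
have := le_trans h (dot_le _ _); rewrite -enorm_sqr expr2.
have [->|n0] := eqVneq (enorm (p - q)) 0; first by rewrite enorm_ge0.
by rewrite ler_pM2r// lt_neqAle eq_sym n0 enorm_ge0.
Qed.

End Projection.

Lemma compact_enorm_bounded K (X : set 'cV[R]_K) y : compact X -> X !=set0 ->
  exists M, forall x, X x -> enorm (y - x) <= M.
Proof.
move=> kX X0.
have [z zX hz] := compact_EVT_max X0 kX (continuous_subspaceT (@dot_dist_continuous _ _ y)).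
exists (enorm (y - z)) => x Xx; rewrite !enormE ler_sqrt ?dot_ge0//.
by apply: hz; rewrite inE.
Qed.

End NearestPoint.

(** * The largest singular value *)

Section SigmaMax.
Variable R : realType.

(** Rayleigh's principle: a maximiser of [|A x|^2] on the unit sphere is an
    eigenvector of [A^T A], since the form [lambda |x|^2 - |A x|^2] is positive
    semidefinite and vanishes there.  Row vectors are used because eigenvectors
    of square matrices are rows. *)
Lemma rayleigh m n (A : 'M[R]_(m, n)) : (0 < n)%N ->
  exists2 l, eigenvalue (A^T *m A) l &
    forall u : 'rV[R]_n, dot (A *m u^T) (A *m u^T) <= l * dot u u.
Proof.
move=> n0; pose f (u : 'rV[R]_n) := dot (A *m u^T) (A *m u^T).
have addc : continuous (fun x : R * R => x.1 + x.2).
  by move=> x; exact: (@pseudometric_normed_Zmodule.add_continuous R R^o x).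
have fc : continuous f.
  apply: dot_self_continuous => i j.
  have -> : (fun u : 'rV[R]_n => (A *m u^T) i j) = (fun u => \sum_k A i k * u j k).
    by apply/funext => u; rewrite mxE; apply: eq_bigr => k _; rewrite mxE.
  apply: (continuous_big addc) => k _ z.
  apply: (@cvgM R _ (nbhs z)); first exact: cvg_cst.
  exact: coord_continuous.
pose S := [set u : 'rV[R]_n | dot u u = 1].
have Sc : compact S.
  apply: bounded_closed_compact.
    exists 1; split; first exact: num_real.
    move=> x x1 u /= Su; apply: le_trans (ltW x1).
    rewrite /Num.norm /= mx_normrE; apply/bigmax_leP; split=> // ij _.
    apply: le_trans (coord_le_enorm _ _ _) _.
    by rewrite enorm_le// Su expr1n.
  rewrite (_ : S = (fun u => dot u u) @^-1` [set x | x = 1])//.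
  apply: preimage_closed; last exact: closed_eq.
  move=> u _; apply: (@dot_self_continuous _ _ _ _ id) => i j.
  exact: coord_continuous.
have S0 : S !=set0.
  exists (delta_mx 0 (Ordinal n0)); rewrite /S /= /dot big_ord1.
  rewrite (bigD1 (Ordinal n0))//= big1 ?mxE ?eqxx ?mulr1 ?addr0// => i ni.
  by rewrite mxE (negPf ni) andbF mul0r.
have [c] := compact_EVT_max S0 Sc (continuous_subspaceT fc).
rewrite inE => Sc1 hc; pose l := f c.
have fl u : f u <= l * dot u u.
  have [->|u0] := eqVneq u 0; first by rewrite /f trmx0 mulmx0 !dot0l mulr0.
  have p : 0 < dot u u.
    by rewrite lt_neqAle dot_ge0 andbT eq_sym; apply: contra_neq u0; exact: dot_eq0.
  have Su : S ((Num.sqrt (dot u u))^-1 *: u).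
    by rewrite /S /= dotZl dotZr mulrA -expr2 exprVn sqr_sqrtr ?dot_ge0// mulVf// gt_eqF.
  have := hc _ (mem_set Su); rewrite -/l /f linearZ /= -scalemxAr dotZl dotZr mulrA.
  by rewrite -expr2 exprVn sqr_sqrtr ?dot_ge0// ler_pdivrMl// mulrC.
exists l => //; apply/eigenvalueP; exists c; last first.
  apply/eqP => c0; move: Sc1; rewrite /S /= c0 dot0l => /esym/eqP.
  by rewrite oner_eq0.
pose w := c *m (A^T *m A) - l *: c.
apply/eqP; rewrite -subr_eq0 -/w; apply/eqP/dot_eq0.
pose G := l * dot w w - f w.
have G0 : 0 <= G by rewrite subr_ge0 fl.
pose b := dot w w.
have cw : dot (A *m c^T) (A *m w^T) = b + l * dot c w.
  rewrite dotC dot_mulmxl mulmxA -dot_trmx trmxK !trmx_mul !trmxK.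
  by rewrite -[LHS](subrK (dot w (l *: c))) -dotBr dotZr (dotC w c).
have h t : 0 <= t ^+ 2 * G - 2 * t * b.
  have := fl (c + t *: w); rewrite /f linearD linearZ /= mulmxDr -scalemxAr.
  rewrite !dot_sqrD !dotZr !dotZl cw -/(f c) -/l -/(f w) Sc1 -/b.
  rewrite /G -/b; lra.
exact: parabola_flat G0 h.
Qed.

Lemma eigenvalue_le_sigma_max m n (A : 'M[R]_(m, n)) l :
  eigenvalue (A^T *m A) l -> Num.sqrt l <= sigma_max A.
Proof.
rewrite eigenvalue_root_char => rl; rewrite /sigma_max /singular_values.
set p := char_poly _ in rl *.
have p0 : p != 0 by apply: monic_neq0; exact: char_poly_monic.
clearbody p.
set s := [seq Num.sqrt x | x <- _].
have ss : sorted <=%R s.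
  apply: (@homo_sorted _ _ Num.sqrt <=%R).
    by move=> x y; exact: ler_wsqrtr.
  rewrite sorted_pairwise; last exact: le_trans.
  have : pairwise <%R (rootsR p).
    by rewrite -sorted_pairwise ?sorted_roots//; exact: lt_trans.
  elim: (rootsR p) => //= x r IH /andP[xr pr].
  rewrite pairwise_cat IH// andbT; apply/andP; split.
    apply/allrelP => y z; rewrite mem_nseq => /andP[_ /eqP ->].
    move=> /flattenP[q /mapP[x' x'r ->]]; rewrite mem_nseq => /andP[_ /eqP ->].
    by move/allP: xr => /(_ _ x'r) /ltW.
  by elim: (mup x p) => //= k ->; rewrite andbT all_nseq lexx orbT.
have lr : l \in rootsR p by rewrite -(roots_on_rootsR p0 l) rl andbT in_itv.
have ls : Num.sqrt l \in s.
  apply: map_f; apply/flattenP; exists (nseq (mup l p) l).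
    by apply/mapP; exists l.
  by rewrite mem_nseq eqxx andbT -XsubC_dvd// dvdp_XsubCl.
clearbody s.
have : Num.sqrt l \in rev s by rewrite mem_rev.
have : sorted (fun x y => y <= x) (rev s) by rewrite rev_sorted.
case: (rev s) => //= x r; rewrite path_sortedE; last by move=> a b c h1 h2; exact: le_trans h2 h1.
by move=> /andP[/allP h _]; rewrite inE => /orP[/eqP ->//|/h].
Qed.

Lemma sigma_max_ge0 m n (A : 'M[R]_(m, n)) : 0 <= sigma_max A.
Proof.
rewrite /sigma_max /singular_values; set s := map _ _.
have : all (fun x => 0 <= x) (rev s).
  by rewrite all_rev; apply/allP => x /mapP[y _ ->]; exact: sqrtr_ge0.
by case: (rev s) => //= x r /andP[].
Qed.

Lemma enorm_mulmx_le m n (A : 'M[R]_(m, n)) (x : 'cV[R]_n) :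
  enorm (A *m x) <= sigma_max A * enorm x.
Proof.
have [n0|n0] := posnP n.
  have -> : x = 0 by apply/matrixP => -[i hi]; exfalso; rewrite n0 in hi.
  by rewrite mulmx0 !enorm0 mulr0.
have [l el hl] := rayleigh A n0.
have := hl x^T; rewrite trmxK dot_trmx => h.
have l0 : 0 <= l.
  have := hl (delta_mx 0 (Ordinal n0)); set e := delta_mx _ _ => he.
  have := le_trans (dot_ge0 _) he; rewrite pmulr_lge0//.
  rewrite lt_neqAle dot_ge0 andbT eq_sym; apply/eqP => /dot_eq0/matrixP/(_ 0 (Ordinal n0)).
  by rewrite !mxE !eqxx => /eqP; rewrite oner_eq0.
apply: le_trans (_ : Num.sqrt l * enorm x <= _); last first.
  by rewrite ler_wpM2r ?enorm_ge0// eigenvalue_le_sigma_max.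
by rewrite !enormE -sqrtrM// ler_sqrt// mulr_ge0 ?dot_ge0.
Qed.

End SigmaMax.

(** * Consensus *)

Section Consensus.
Variable R : realType.

(** Jensen's inequality for the square norm: the gap between the two sides is
    the weighted variance of the [r u]. *)
Lemma jensen_dot (m K1 K2 : nat) (p : 'I_m -> R) (r : 'I_m -> 'M[R]_(K1, K2)) :
  (forall u, 0 <= p u) -> \sum_u p u = 1 ->
  dot (\sum_u p u *: r u) (\sum_u p u *: r u) <= \sum_u p u * dot (r u) (r u).
Proof.
move=> p0 p1; set s := \sum_u p u *: r u.
have : 0 <= \sum_u p u * dot (r u - s) (r u - s).
  by apply: sumr_ge0 => u _; rewrite mulr_ge0// dot_ge0.
have -> : \sum_u p u * dot (r u - s) (r u - s) =
    \sum_u p u * dot (r u) (r u) - 2 * dot s s + dot s s.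
  transitivity (\sum_u (p u * dot (r u) (r u) - 2 * (p u * dot (r u) s)
                        + p u * dot s s)).
    apply: eq_bigr => u _.
    by rewrite dotBl !dotBr (dotC s); ring.
  rewrite !big_split /= -mulr_suml p1 mul1r; congr (_ + _ + _).
  rewrite sumrN -mulr_sumr; congr (- (_ * _)).
  by rewrite {3}/s dot_suml; apply: eq_bigr => u _; rewrite dotZl.
lra.
Qed.

Lemma row_mulmx_sum N K (P : 'M[R]_N) (M : 'M[R]_(N, K)) i :
  row i (P *m M) = \sum_u P i u *: row u M.
Proof.
apply/matrixP => a j; rewrite !mxE summxE; apply: eq_bigr => u _.
by rewrite !mxE.
Qed.

Lemma doubly_stochastic_enorm N K (P : 'M[R]_N) (M : 'M[R]_(N, K)) :
  doubly_stochastic P -> enorm (P *m M) <= enorm M.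
Proof.
move=> [[P0 Pr] [_ Pc]]; rewrite enorm_le ?enorm_ge0// enorm_sqr dot_row.
apply: le_trans (_ : \sum_i \sum_u P i u * dot (row u M) (row u M) <= _).
  by apply: ler_sum => i _; rewrite row_mulmx_sum; exact: jensen_dot.
rewrite exchange_big /= [leRHS]dot_row; apply: ler_sum => u _.
rewrite -mulr_suml (_ : \sum_i P i u = 1) ?mul1r//.
by rewrite -[RHS](Pc u); apply: eq_bigr => i _; rewrite mxE.
Qed.

Lemma row_stack N K (th : 'I_N -> 'cV[R]_K) v : row v (stack th) = (th v)^T.
Proof. by apply/matrixP => i j; rewrite !mxE ord1. Qed.

Lemma stackD N K (th1 th2 : 'I_N -> 'cV[R]_K) :
  stack (fun v => th1 v + th2 v) = stack th1 + stack th2.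
Proof. by apply/matrixP => i j; rewrite !mxE. Qed.

Section Centering.
Variable N : nat.
Hypothesis N0 : (0 < N)%N.

Local Notation Q := (Qmat R N).

Let N_neq0 : N%:R != 0 :> R. Proof. by rewrite pnatr_eq0 -lt0n. Qed.

Lemma Qmat_tr : Q^T = Q.
Proof. by rewrite /Qmat linearB /= trmx1 trmx_const. Qed.

Lemma Qmat_comm (P : 'M[R]_N) : doubly_stochastic P -> Q *m P = P *m Q.
Proof.
move=> [[_ Pr] [_ Pc]]; rewrite /Qmat mulmxBl mulmxBr mul1mx mulmx1; congr (_ - _).
apply/matrixP => i j; rewrite !mxE.
transitivity (N%:R^-1 : R).
  under eq_bigr do rewrite mxE.
  rewrite -mulr_sumr (_ : \sum_i P i j = 1) ?mulr1//.
  by rewrite -[RHS](Pc j); apply: eq_bigr => k _; rewrite mxE.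
under eq_bigr do rewrite mxE.
by rewrite -mulr_suml Pr mul1r.
Qed.

Lemma Qmat_idem : Q *m Q = Q.
Proof.
have JJ : (const_mx N%:R^-1 : 'M[R]_N) *m (const_mx N%:R^-1 : 'M[R]_N) = const_mx N%:R^-1.
  apply/matrixP => i j; rewrite !mxE; under eq_bigr do rewrite !mxE.
  by rewrite sumr_const card_ord -[LHS]mulr_natl mulrA divff// mul1r.
by rewrite /Qmat mulmxBr mulmx1 mulmxBl mul1mx JJ subrr subr0.
Qed.

Lemma enorm_Qmat K (M : 'M[R]_(N, K)) : enorm (Q *m M) <= enorm M.
Proof.
have h : dot (Q *m M) (Q *m M) <= enorm M * enorm (Q *m M).
  by rewrite dot_mulmxl Qmat_tr mulmxA Qmat_idem dot_le.
have [->|n0] := eqVneq (enorm (Q *m M)) 0; first exact: enorm_ge0.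
rewrite -(@ler_pM2r _ (enorm (Q *m M))); last by rewrite lt_neqAle eq_sym n0 enorm_ge0.
by rewrite -expr2 enorm_sqr.
Qed.

Lemma row_Qmat_stack K (th : 'I_N -> 'cV[R]_K) v :
  row v (Q *m stack th) = (th v - mean_vec th)^T.
Proof.
apply/matrixP => i j; rewrite /Qmat mulmxBl mul1mx !mxE; rewrite (ord1 i); congr (_ - _).
rewrite summxE mulr_sumr; apply: eq_bigr => u _.
by rewrite !mxE.
Qed.

Lemma dist_mean_le K (th : 'I_N -> 'cV[R]_K) v :
  enorm (th v - mean_vec th) <= enorm (Q *m stack th).
Proof. by rewrite -enorm_tr -row_Qmat_stack; exact: enorm_row_le. Qed.

Lemma mean_vec_mix K (P : 'M[R]_N) (th : 'I_N -> 'cV[R]_K) :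
  doubly_stochastic P ->
  mean_vec (fun v => \sum_u P v u *: th u) = mean_vec th.
Proof.
move=> [_ [_ Pc]]; congr (_ *: _); rewrite exchange_big; apply: eq_bigr => u _ /=.
rewrite -scaler_suml (_ : \sum_i P i u = 1) ?scale1r//.
by rewrite -[RHS](Pc u); apply: eq_bigr => i _; rewrite mxE.
Qed.

Lemma stack_mix K (P : 'M[R]_N) (th : 'I_N -> 'cV[R]_K) :
  stack (fun v => \sum_u P v u *: th u) = P *m stack th.
Proof.
apply/matrixP => i j; rewrite !mxE summxE; apply: eq_bigr => u _.
by rewrite !mxE.
Qed.

Lemma mix_dist_mean_le K (P : 'M[R]_N) (th : 'I_N -> 'cV[R]_K) v :
  doubly_stochastic P ->
  enorm (\sum_u P v u *: th u - mean_vec th) <= enorm (Q *m stack th).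
Proof.
move=> dP; rewrite -(mean_vec_mix th dP).
apply: le_trans (dist_mean_le (fun v => \sum_u P v u *: th u) v) _.
by rewrite stack_mix mulmxA Qmat_comm// -mulmxA doubly_stochastic_enorm.
Qed.

Section Mixing.
Variables (K B : nat) (W : nat -> 'M[R]_N) (eta : R).
Hypotheses (dW : forall k, doubly_stochastic (W k)) (eta0 : 0 <= eta).
Hypothesis mixing : forall k (M : 'M[R]_(N, K)),
  enorm (Wprod W k B *m Q *m M) <= eta * enorm (Q *m M).

Lemma Wprod_add k a b : Wprod W k (a + b) = Wprod W (k + a) b *m Wprod W k a.
Proof.
elim: b => [|b IH]; first by rewrite addn0 mul1mx.
by rewrite addnS /= IH mulmxA addnA.
Qed.

Lemma Wprod_enorm k m (M : 'M[R]_(N, K)) : enorm (Wprod W k m *m M) <= enorm M.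
Proof.
elim: m => [|m IH] /=; first by rewrite mul1mx.
by rewrite -mulmxA; apply: le_trans IH; exact: doubly_stochastic_enorm.
Qed.

Lemma Qmat_Wprod k m : Q *m Wprod W k m = Wprod W k m *m Q.
Proof.
elim: m => [|m IH] /=; first by rewrite mul1mx mulmx1.
by rewrite mulmxA Qmat_comm// -mulmxA IH mulmxA.
Qed.

(** Only complete blocks of [B] steps are known to contract, whence the integer
    division in the exponent; the remaining steps do not expand. *)
Lemma Wprod_contract k m (M : 'M[R]_(N, K)) :
  enorm (Wprod W k m *m (Q *m M)) <= eta ^+ (m %/ B) * enorm (Q *m M).
Proof.
have blocks q : enorm (Wprod W k (q * B) *m (Q *m M)) <= eta ^+ q * enorm (Q *m M).
  elim: q => [|q IH]; first by rewrite mul0n mul1mx expr0 mul1r.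
  rewrite mulSn addnC Wprod_add -mulmxA (mulmxA (Wprod W k _)) -Qmat_Wprod.
  rewrite -(mulmxA Q) (mulmxA _ Q).
  apply: le_trans (mixing _ _) _; rewrite mulmxA Qmat_Wprod -mulmxA exprS -mulrA.
  by rewrite ler_wpM2l.
rewrite {1}(divn_eq m B) Wprod_add -mulmxA.
by apply: le_trans (blocks _); exact: Wprod_enorm.
Qed.

Lemma consensus_bound (Th Pt : nat -> 'M[R]_(N, K)) (c : nat -> R) :
  (forall t, Th t.+1 = W t *m Th t + Pt t) -> (forall t, enorm (Pt t) <= c t) ->
  forall t, enorm (Q *m Th t) <= eta ^+ (t %/ B) * enorm (Q *m Th 0%N)
    + \sum_(r < t) eta ^+ ((t - r.+1) %/ B) * c r.
Proof.
move=> hTh hP t.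
have unroll : Q *m Th t = Wprod W 0 t *m (Q *m Th 0%N)
    + \sum_(r < t) Wprod W r.+1 (t - r.+1) *m (Q *m Pt r).
  elim: t => [|t IH]; first by rewrite big_ord0 addr0 mul1mx.
  rewrite hTh mulmxDr mulmxA Qmat_comm// -mulmxA IH mulmxDr /= add0n -addrA mulmxA.
  congr (_ + _); rewrite big_ord_recr /= subnn mul1mx; congr (_ + _).
  rewrite mulmx_sumr; apply: eq_bigr => r _.
  by rewrite subSn//= mulmxA subnKC.
rewrite unroll; apply: le_trans (enormD _ _) _; apply: lerD; first exact: Wprod_contract.
apply: le_trans (enorm_sum _ _ _) _; apply: ler_sum => r _.
apply: le_trans (Wprod_contract _ _ _) _; rewrite ler_wpM2l ?exprn_ge0//.
exact: le_trans (enorm_Qmat _) (hP r).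
Qed.

End Mixing.
End Centering.
End Consensus.

(** * The temporal-difference matrices *)

Section TDMatrices.
Variables (R : realType) (n : nat) (P : 'M[R]_n) (pi : 'rV[R]_n).
Hypotheses (sP : stochastic P) (stP : stationary P pi).

Let pi0 i : 0 <= pi 0 i. Proof. by case: stP. Qed.

Definition dotD (u v : 'cV[R]_n) : R := \sum_i pi 0 i * (u i 0 * v i 0).

Lemma sqnormDE u : sqnormD pi u = dotD u u.
Proof.
rewrite /sqnormD -mulmxA mxE; apply: eq_bigr => i _; rewrite !mxE.
rewrite (bigD1 i)//= big1 ?mxE ?eqxx ?addr0; first by rewrite mulr1n; ring.
by move=> j ji; rewrite mxE eq_sym (negPf ji) mulr0n mul0r.
Qed.

Lemma sqnormD_ge0 u : 0 <= sqnormD pi u.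
Proof.
rewrite sqnormDE; apply: sumr_ge0 => i _.
by rewrite mulr_ge0// -expr2 sqr_ge0.
Qed.

Lemma sqnormDB u v t :
  sqnormD pi (u - t *: v) = sqnormD pi u - 2 * t * dotD u v + t ^+ 2 * sqnormD pi v.
Proof.
rewrite !sqnormDE /dotD !mulr_sumr -sumrN -!big_split; apply: eq_bigr => i _.
by rewrite !mxE /=; ring.
Qed.

Lemma sqnormD_convex u v a b : 0 <= a -> 0 <= b -> 0 < a + b ->
  (a + b) * sqnormD pi ((a + b)^-1 *: (a *: u + b *: v))
    <= a * sqnormD pi u + b * sqnormD pi v.
Proof.
move=> a0 b0 ab0; rewrite !sqnormDE /dotD !mulr_sumr -big_split.
apply: ler_sum => i _; rewrite !mxE /=.
set x := u i 0; set y := v i 0.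
have -> : a * (pi 0 i * (x * x)) + b * (pi 0 i * (y * y)) =
    (a + b) * (pi 0 i * ((a + b)^-1 * (a * x + b * y) * ((a + b)^-1 * (a * x + b * y))))
    + pi 0 i * (a * b / (a + b) * (x - y) ^+ 2) by field; rewrite gt_eqF.
rewrite lerDl mulr_ge0//; apply: mulr_ge0; last exact: sqr_ge0.
by rewrite divr_ge0 ?mulr_ge0// ltW.
Qed.

Lemma Epi_cst_sum : \sum_i \sum_j pi 0 i * P i j = 1.
Proof.
under eq_bigr do rewrite -mulr_sumr sP.2 mulr1.
by case: stP.
Qed.

Lemma stationary_col j : \sum_i pi 0 i * P i j = pi 0 j.
Proof. by case: stP => _ _ /matrixP/(_ 0 j); rewrite mxE. Qed.

(** Mass reaches every state from the charged ones, since [pi = pi P^m]. *)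
Lemma stationary_gt0 : irreducible P -> forall j, 0 < pi 0 j.
Proof.
move=> irrP j; have [_ p1 pP] := stP.
have [i i0] : exists i, 0 < pi 0 i.
  apply/existsP; apply: contraT; rewrite negb_exists => /forallP h.
  move: p1; rewrite big1 ?(eqP _)//; first by move=> /esym/eqP; rewrite oner_eq0.
  by move=> i _; apply/eqP; rewrite eq_le pi0 leNgt h.
have [m mij] := irrP i j.
have pPm : pi *m P ^+ m = pi.
  elim: m {mij} => [|m IH]; first by rewrite expr0 mulmx1.
  by rewrite exprS -[P * _]/(P *m _) mulmxA pP.
have Pm0 a b : 0 <= (P ^+ m) a b.
  elim: m {mij pPm} a b => [|m IH] a b; first by rewrite expr0 mxE ler0n.
  by rewrite exprS -[P * _]/(P *m _) mxE sumr_ge0// => k _; rewrite mulr_ge0// sP.1.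
rewrite -pPm mxE (bigD1 i)//= ltr_pwDl ?mulr_gt0// sumr_ge0// => k _.
by rewrite mulr_ge0.
Qed.

Section Features.
Variables (N K : nat) (gamma : R) (Rw : 'I_N -> 'I_n -> 'I_n -> R) (Phi : 'M[R]_(n, K)).
Hypothesis gamma01 : 0 < gamma < 1.

Local Notation A := (Amat P pi gamma Phi).
Local Notation b := (bvec P pi Rw Phi).

Lemma JtildeE x i : Jtilde Phi x i 0 = dot (phi Phi i) x.
Proof.
by rewrite mxE /dot; apply: eq_bigr => k _; rewrite big_ord1 !mxE.
Qed.

Lemma JtildeB x y : Jtilde Phi x - Jtilde Phi y = Jtilde Phi (x - y).
Proof. by rewrite /Jtilde mulmxBr. Qed.

Lemma Amat_mulmx x : A *m x = \sum_i \sum_j (pi 0 i * P i j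
    * (Jtilde Phi x i 0 - gamma * Jtilde Phi x j 0)) *: phi Phi i.
Proof.
rewrite /Amat /Epi mulmx_suml; apply: eq_bigr => i _.
rewrite mulmx_suml; apply: eq_bigr => j _.
rewrite -scalemxAl -mulmxA [X in _ *m X]mx11_scalar mul_mx_scalar scalerA.
by rewrite dot_mxE dotBl dotZl !JtildeE.
Qed.

(** The stationary law is the law of both the current and the next state, so
    that the cross term [J i * J j] is at most [|J|_D^2] on average. *)
Lemma Amat_coercive x :
  (1 - gamma) * sqnormD pi (Jtilde Phi x) <= dot x (A *m x).
Proof.
have [g0 g1] := andP gamma01.
pose J i := Jtilde Phi x i 0.
have nE : sqnormD pi (Jtilde Phi x) = \sum_i \sum_j pi 0 i * P i j * J i ^+ 2.
  rewrite sqnormDE; apply: eq_bigr => i _.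
  by rewrite -mulr_suml -mulr_sumr sP.2 mulr1 expr2.
have nE' : sqnormD pi (Jtilde Phi x) = \sum_i \sum_j pi 0 i * P i j * J j ^+ 2.
  rewrite sqnormDE exchange_big; apply: eq_bigr => i _ /=.
  by rewrite -mulr_suml stationary_col expr2.
have -> : dot x (A *m x) = \sum_i \sum_j pi 0 i * P i j * (J i ^+ 2 - gamma * (J i * J j)).
  rewrite Amat_mulmx dot_sumr; apply: eq_bigr => i _; rewrite dot_sumr.
  by apply: eq_bigr => j _; rewrite dotZr dotC -JtildeE -/(J i) -/(J j); ring.
have -> : (1 - gamma) * sqnormD pi (Jtilde Phi x) =
    \sum_i \sum_j pi 0 i * P i j * (J i ^+ 2 - gamma / 2 * (J i ^+ 2 + J j ^+ 2)).
  transitivity (sqnormD pi (Jtilde Phi x) - gamma / 2 *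
     (sqnormD pi (Jtilde Phi x) + sqnormD pi (Jtilde Phi x))); first by field.
  rewrite {1 2}nE {1}nE' -big_split mulr_sumr -sumrN -big_split; apply: eq_bigr => i _ /=.
  rewrite -big_split mulr_sumr -sumrN -big_split; apply: eq_bigr => j _ /=; ring.
apply: ler_sum => i _; apply: ler_sum => j _.
rewrite ler_wpM2l ?mulr_ge0// ?sP.1// lerD2l lerN2 -mulrA ler_wpM2l ?(ltW g0)//.
have := sqr_ge0 (J i - J j); rewrite sqrrB; lra.
Qed.

Lemma td_noise_centered v th :
  \sum_i \sum_j (pi 0 i * P i j) *: td_noise P pi gamma Rw Phi v th i j = 0.
Proof.
rewrite /td_noise.
transitivity (\sum_i \sum_j ((pi 0 i * P i j * td_error gamma Rw Phi v th i j) *: phi Phi i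
   - (pi 0 i * P i j) *: td_mean P pi gamma Rw Phi v th)).
  by apply: eq_bigr => i _; apply: eq_bigr => j _; rewrite scalerBr scalerA.
under eq_bigr do rewrite sumrB.
rewrite sumrB [X in _ - X](_ : _ = td_mean P pi gamma Rw Phi v th); last first.
  under eq_bigr do rewrite -scaler_suml.
  by rewrite -scaler_suml Epi_cst_sum scale1r.
apply/eqP; rewrite subr_eq0; apply/eqP.
rewrite /td_mean Amat_mulmx /bvec /Epi -sumrB; apply: eq_bigr => i _.
rewrite -sumrB; apply: eq_bigr => j _.
rewrite scalerA -scalerBl; congr (_ *: _).
rewrite /td_error dot_mxE dotBr dotZr !JtildeE !(dotC th); ring.
Qed.

Hypothesis irrP : irreducible P.
Hypothesis rkPhi : \rank Phi = K.

Lemma Jtilde_inj x : Jtilde Phi x = 0 -> x = 0.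
Proof.
move=> /(congr1 trmx); rewrite trmx_mul trmx0 => h.
have fr : row_free Phi^T by rewrite /row_free mxrank_tr rkPhi.
apply: trmx_inj; rewrite trmx0; apply: (row_free_inj fr).
by rewrite h mul0mx.
Qed.

Lemma gram_unitmx : Phi^T *m diag_mx pi *m Phi \in unitmx.
Proof.
rewrite -row_free_unit -kermx_eq0; apply/rowV0P => u /sub_kermxP uG.
apply: trmx_inj; rewrite trmx0; apply: Jtilde_inj; apply/matrixP => i k.
rewrite ord1 [RHS]mxE.
have : sqnormD pi (Jtilde Phi u^T) = 0.
  by rewrite /sqnormD /Jtilde trmx_mul trmxK !mulmxA -2!(mulmxA u) uG !mul0mx mxE.
move/eqP; rewrite sqnormDE psumr_eq0; last first.
  by move=> j _; rewrite mulr_ge0// -expr2 sqr_ge0.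
move=> /allP/(_ i (mem_index_enum _)); rewrite /= mulf_eq0 gt_eqF ?stationary_gt0//=.
by rewrite -expr2 sqrf_eq0 => /eqP.
Qed.

Lemma dotD_Jtilde u x : dotD u (Jtilde Phi x) = dot (Phi^T *m diag_mx pi *m u) x.
Proof.
rewrite -mulmxA dot_mulmxl trmxK /dotD /dot; apply: eq_bigr => i _.
by rewrite big_ord1 mul_diag_mx [X in _ = X * _]mxE /Jtilde mulrA.
Qed.

(** The features being independent, the normal equations have a solution; it
    is a nearest point, so that the projection is not a default value. *)
Lemma proj_range_nearest T x :
  normD pi (T - proj_on (normD pi) (range (Jtilde Phi)) T)
    <= normD pi (T - Jtilde Phi x).
Proof.
set S := [set z | range (Jtilde Phi) z /\ forall y, range (Jtilde Phi) y ->
  normD pi (T - z) <= normD pi (T - y)].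
suff : S (proj_on (normD pi) (range (Jtilde Phi)) T).
  by move=> [_]; apply; exists x.
apply: xgetPex.
pose x1 := invmx (Phi^T *m diag_mx pi *m Phi) *m (Phi^T *m diag_mx pi *m T).
exists (Jtilde Phi x1); split; first by exists x1.
move=> _ [y _ <-]; rewrite /normD ler_wsqrtr//.
have -> : T - Jtilde Phi y = (T - Jtilde Phi x1) - (-1) *: Jtilde Phi (x1 - y).
  by rewrite -JtildeB scaleN1r opprK addrA subrK.
rewrite [leRHS]sqnormDB dotD_Jtilde.
rewrite mulmxBr /Jtilde (mulmxA _ Phi x1) /x1 mulKVmx ?gram_unitmx// subrr.
by rewrite dot0l mulr0 subr0 lerDl mulr_ge0 ?sqr_ge0 ?sqnormD_ge0.
Qed.

Lemma projected_bellman_normal_eq th : (0 < N)%N ->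
  projected_bellman_solution P pi gamma Rw Phi th ->
  A *m th = N%:R^-1 *: \sum_v b v.
Proof.
move=> N0 pb; set T := bellman P gamma Rw (Jtilde Phi th) in pb.
pose w := N%:R^-1 *: \sum_v b v - A *m th.
apply/esym/eqP; rewrite -subr_eq0 -/w; apply/eqP/dot_eq0.
have orth x : dotD (T - Jtilde Phi th) (Jtilde Phi x) = 0.
  apply: (@parabola_flat _ (sqnormD pi (Jtilde Phi x))); first exact: sqnormD_ge0.
  move=> t; have := proj_range_nearest T (th + t *: x); rewrite pb.
  rewrite /normD ler_sqrt ?sqnormD_ge0//.
  have -> : T - Jtilde Phi (th + t *: x) = (T - Jtilde Phi th) - t *: Jtilde Phi x.
    by rewrite /Jtilde mulmxDr -scalemxAr opprD addrA.
  by rewrite [leRHS]sqnormDB; lra.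
rewrite -[RHS](orth w); apply/esym.
pose J i := Jtilde Phi th i 0.
transitivity (\sum_i \sum_j pi 0 i * P i j *
   (N%:R^-1 * (\sum_v Rw v i j) + gamma * J j - J i) * dot (phi Phi i) w).
  rewrite /dotD; apply: eq_bigr => i _; rewrite -mulr_suml mulrA; congr (_ * _); last first.
    by rewrite JtildeE.
  rewrite /T !mxE -/(J i); under [RHS]eq_bigr do rewrite -mulrA mulrBr.
  rewrite -mulr_sumr sumrB -mulr_suml sP.2 mul1r; congr (_ * (_ - _)).
  by rewrite /J !mxE.
have bE : dot (\sum_v b v) w =
    \sum_i \sum_j pi 0 i * P i j * (\sum_v Rw v i j) * dot (phi Phi i) w.
  rewrite dot_suml.
  transitivity (\sum_v \sum_i \sum_j pi 0 i * P i j * Rw v i j * dot (phi Phi i) w).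
    apply: eq_bigr => v _; rewrite dot_suml; apply: eq_bigr => i _.
    by rewrite dot_suml; apply: eq_bigr => j _; rewrite scalerA dotZl.
  rewrite exchange_big; apply: eq_bigr => i _; rewrite exchange_big.
  by apply: eq_bigr => j _ /=; rewrite -mulr_suml -mulr_sumr.
rewrite {2}/w dotBl dotZl bE Amat_mulmx dot_suml mulr_sumr -sumrB.
apply: eq_bigr => i _; rewrite mulr_sumr dot_suml -sumrB.
by apply: eq_bigr => j _; rewrite dotZl -/(J i) -/(J j); ring.
Qed.

End Features.
End TDMatrices.

(** * One step of the algorithm along a sample path *)

Section ProjectedStep.
Variables (R : realType) (K : nat) (X : set 'cV[R]_K).
Hypotheses (cX : convex_set (X : set (convex_lmodType 'cV[R]_K)))
  (kX : compact X) (X0 : X !=set0).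
Variables (y g : 'cV[R]_K) (a : R).
Hypotheses (Xy : X y) (a0 : 0 <= a).

Let z := proj_on (@enorm R K 1) X (y + a *: g).

Lemma proj_step_enorm : enorm (z - y) <= a * enorm g.
Proof.
have := proj_on_obtuse cX kX X0 (y + a *: g) Xy; rewrite -/z => h.
have hp : dot (z - y) (z - y) <= a * dot g (z - y).
  move: h; have -> : y + a *: g - z = a *: g - (z - y).
    by apply/matrixP => i j; rewrite !mxE; ring.
  rewrite -(opprB z y) dotNr (dotBl (a *: g)) dotZl; lra.
have [->|n0] := eqVneq (enorm (z - y)) 0; first by rewrite mulr_ge0// enorm_ge0.
have p0 : 0 < enorm (z - y) by rewrite lt_neqAle eq_sym n0 enorm_ge0.
rewrite -(ler_pM2r p0) -expr2 enorm_sqr; apply: le_trans hp _.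
by rewrite -mulrA ler_wpM2l// dot_le.
Qed.

(** The displacement [z - y] is the gradient step [a g] plus a projection error
    [e], and [<e, z - x> <= 0] for every [x] of [X]: towards the points of [X],
    the error can only help, up to the distance from [c] to [y] and to terms of
    order [a ^ 2]. *)
Lemma proj_step_dot c x : X x ->
  dot (c - x) (z - y) <= a * dot (c - x) g + a * enorm g * enorm (c - y)
                         + a ^+ 2 * enorm g ^+ 2 / 4.
Proof.
move=> Xx; pose p := z - y; pose e := p - a *: g.
have eE : e = - (y + a *: g - z).
  by rewrite /e /p; apply/matrixP => i j; rewrite !mxE; ring.
have h1 : dot (z - x) e <= 0.
  have := proj_on_obtuse cX kX X0 (y + a *: g) Xx; rewrite -/z.
  by rewrite -(opprB z x) dotNr dotC -dotNr -eE.
have h2 : dot (c - y) e <= a * enorm g * enorm (c - y).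
  apply: le_trans (dot_le _ _) _; rewrite mulrC ler_wpM2r ?enorm_ge0//.
  have [_ /(_ _ Xy)] := proj_onP kX X0 (y + a *: g); rewrite -/z.
  have -> : y + a *: g - y = a *: g by rewrite addrC addKr.
  by rewrite eE enormN enormZ ger0_norm.
have h3 : - dot p e <= a ^+ 2 * enorm g ^+ 2 / 4.
  have := dot_ge0 (p - (a / 2) *: g).
  have -> : dot p e = dot p p - a * dot p g by rewrite (dotBr p) dotZr.
  rewrite (dot_sqrD p) dotNl !dotNr dotZl !dotZr enorm_sqr; lra.
have -> : dot (c - x) (z - y) = a * dot (c - x) g
   + (dot (z - x) e + dot (c - y) e - dot p e).
  rewrite -dotDl -dotBl -dotZr.
  have -> : z - x + (c - y) - p = c - x.
    by rewrite /p; apply/matrixP => i j; rewrite !mxE; ring.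
  by rewrite -dotDr; congr (dot _ _); rewrite /e subrKC.
lra.
Qed.

End ProjectedStep.

Section SamplePath.
Variables (R : realType) (N n K : nat) (P : 'M[R]_n) (pi : 'rV[R]_n) (gamma : R).
Variables (Rw : 'I_N -> 'I_n -> 'I_n -> R) (Phi : 'M[R]_(n, K)).
Variables (W : nat -> 'M[R]_N) (X : set 'cV[R]_K) (thetastar : 'cV[R]_K).
Variables (alpha : nat -> R) (Lv : 'I_N -> R).

Local Notation A := (Amat P pi gamma Phi).
Local Notation Q := (Qmat R N).

Definition deviation (th : 'I_N -> 'cV[R]_K) : 'cV[R]_K := mean_vec th - thetastar.

Definition noise_term (th : 'I_N -> 'cV[R]_K) (i j : 'I_n) : R :=
  N%:R^-1 * \sum_v dot (deviation th) (td_noise P pi gamma Rw Phi v (th v) i j).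

Definition drift (th : 'I_N -> 'cV[R]_K) : R :=
  dot (deviation th) (A *m deviation th).

Definition disagreement (th : 'I_N -> 'cV[R]_K) : R := enorm (Q *m stack th).

Definition value_error (th : 'cV[R]_K) : R :=
  sqnormD pi (Jtilde Phi th - Jtilde Phi thetastar).

Hypothesis N0 : (0 < N)%N.
Hypotheses (cX : convex_set (X : set (convex_lmodType 'cV[R]_K)))
  (kX : compact X) (Xstar : X thetastar).
Hypothesis dW : forall k, doubly_stochastic (W k).
Hypothesis alpha0 : forall k, 0 < alpha k.

Variables (theta0 : 'I_N -> 'cV[R]_K) (s s' : nat -> 'I_n).
Hypothesis Xtheta0 : forall v, X (theta0 v).

Local Notation th := (td_iter gamma Rw Phi X W alpha theta0 s s').
Local Notation thhat := (td_avg gamma Rw Phi X W alpha theta0 s s').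

Let X0 : X !=set0. Proof. by exists thetastar. Qed.

Let NR0 : 0 < N%:R :> R. Proof. by rewrite ltr0n. Qed.

Let NR1 : 1 <= N%:R :> R. Proof. by rewrite ler1n. Qed.

Lemma td_iter_in k v : X (th k v).
Proof. by case: k => [|k] //=; exact: proj_on_in. Qed.

Lemma mix_in k (q : 'I_N -> 'cV[R]_K) v : (forall u, X (q u)) ->
  X (\sum_u W k v u *: q u).
Proof. by move=> Xq; have [[W0 W1] _] := dW k; apply: convex_set_sum. Qed.

Lemma mean_vec_in (q : 'I_N -> 'cV[R]_K) : (forall u, X (q u)) -> X (mean_vec q).
Proof.
move=> Xq; rewrite /mean_vec scaler_sumr; apply: convex_set_sum => //.
by rewrite sumr_const card_ord -[LHS]mulr_natr mulVf// gt_eqF.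
Qed.

Section Radius.

Let R0 := sup [set enorm (t - thetastar) | t in X].

Lemma radiusP x : X x -> enorm (x - thetastar) <= R0.
Proof.
move=> Xx; apply: sup_ubound; last by exists x.
have [M hM] := compact_enorm_bounded thetastar kX X0.
by exists M => _ [y Xy <-]; rewrite enormB hM.
Qed.

Lemma radius_ge0 : 0 <= R0.
Proof. exact: le_trans (enorm_ge0 _) (radiusP Xstar). Qed.

Hypotheses (sP : stochastic P) (stP : stationary P pi) (gamma01 : 0 < gamma < 1).

(** Coercivity bounds the error of one agent by the quadratic form of [A] at its
    parameter.  Replacing the agent by the mean changes one argument of the form
    at a time, by at most the disagreement, the other argument being a difference
    of points of [X] with the optimum. *)
Lemma value_error_le (q : 'I_N -> 'cV[R]_K) v : (forall u, X (q u)) ->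
  (1 - gamma) * value_error (q v)
    <= drift q + 2 * (sigma_max A * R0) * disagreement q.
Proof.
move=> Xq; rewrite /value_error JtildeB.
apply: le_trans (Amat_coercive sP stP Phi gamma01 _) _.
pose e := q v - mean_vec q; pose x := deviation q; pose xv := q v - thetastar.
have xvE : xv = x + e by rewrite /x /e /deviation addrC addrA subrK.
have eq : enorm e <= disagreement q by exact: dist_mean_le.
have xR : enorm x <= R0 by apply: radiusP; exact: mean_vec_in.
have xvR : enorm xv <= R0 by apply: radiusP.
have -> : dot xv (A *m xv) = drift q + dot e (A *m xv) + dot x (A *m e).
  by rewrite {1}xvE dotDl {1}xvE mulmxDr dotDr /drift -/x; ring.
have s0 := sigma_max_ge0 A.
have h1 : dot e (A *m xv) <= sigma_max A * R0 * disagreement q.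
  apply: le_trans (dot_le _ _) _; rewrite mulrC ler_pM ?enorm_ge0//.
  by apply: le_trans (enorm_mulmx_le _ _) _; rewrite ler_wpM2l.
have h2 : dot x (A *m e) <= sigma_max A * R0 * disagreement q.
  apply: le_trans (dot_le _ _) _; rewrite [_ * R0]mulrC -mulrA ler_pM ?enorm_ge0//.
  by apply: le_trans (enorm_mulmx_le _ _) _; rewrite ler_wpM2l.
rewrite -/xv; lra.
Qed.

End Radius.

Hypothesis optimal : A *m thetastar = N%:R^-1 *: \sum_v bvec P pi Rw Phi v.
Hypothesis Lv0 : forall v, 0 < Lv v.

Local Notation L := (\sum_v Lv v).

Let L0 : 0 <= L. Proof. by apply: sumr_ge0 => v _; exact: ltW. Qed.

Lemma mean_field (q : 'I_N -> 'cV[R]_K) :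
  N%:R^-1 *: \sum_v td_mean P pi gamma Rw Phi v (q v) = - (A *m deviation q).
Proof.
rewrite /td_mean sumrB scalerBr -optimal -mulmx_sumr scalemxAr -mulmxBr.
by rewrite -mulmxN opprB.
Qed.

Lemma drift_mean (q : 'I_N -> 'cV[R]_K) :
  drift q = - (N%:R^-1 * \sum_v dot (deviation q) (td_mean P pi gamma Rw Phi v (q v))).
Proof. by rewrite -dot_sumr -dotZr mean_field dotNr opprK. Qed.

Hypothesis bounded_step : forall v k,
  enorm (td_mean P pi gamma Rw Phi v (th k v))
  + enorm (td_noise P pi gamma Rw Phi v (th k v) (s k) (s' k)) <= Lv v.

Let step k v := td_error gamma Rw Phi v (th k v) (s k) (s' k) *: phi Phi (s k).

Let stepE k v : step k v = td_mean P pi gamma Rw Phi v (th k v)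
  + td_noise P pi gamma Rw Phi v (th k v) (s k) (s' k).
Proof. by rewrite /td_noise addrC subrK. Qed.

Let step_le k v : enorm (step k v) <= Lv v.
Proof. by rewrite stepE; exact: le_trans (enormD _ _) (bounded_step v k). Qed.

Let mixed k v := \sum_u W k v u *: th k u.

Let thS k v : th k.+1 v = proj_on (@enorm R K 1) X (mixed k v + alpha k *: step k v).
Proof. by rewrite /step scalerA. Qed.

Let move k v := th k.+1 v - mixed k v.

Let move_le k v : enorm (move k v) <= alpha k * Lv v.
Proof.
rewrite /move thS; apply: le_trans (proj_step_enorm _ _ _ _ _ _) _ => //.
- by apply: mix_in => u; exact: td_iter_in.
- exact: ltW.
- by rewrite ler_wpM2l ?step_le// ltW.
Qed.

Let deviationS k : deviation (th k.+1) = deviation (th k) + N%:R^-1 *: \sum_v move k v.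
Proof.
have e : mean_vec (th k.+1) = mean_vec (th k) + N%:R^-1 *: \sum_v move k v.
  by rewrite -(mean_vec_mix (th k) (dW k)) /mean_vec /move sumrB scalerBr subrKC.
by rewrite /deviation e addrAC.
Qed.

Let mean_move_le k : enorm (N%:R^-1 *: \sum_v move k v) <= alpha k * (L / N%:R).
Proof.
rewrite enormZ ger0_norm ?invr_ge0 ?ler0n// mulrC mulrA ler_wpM2r ?invr_ge0 ?ler0n//.
apply: le_trans (enorm_sum _ _ _) _; rewrite mulr_sumr.
by apply: ler_sum => v _; exact: move_le.
Qed.

Lemma deviation_le k :
  enorm (deviation (th k)) <= enorm (deviation (th k.+1)) + alpha k * (L / N%:R).
Proof.
rewrite deviationS; set x := deviation _; set y := N%:R^-1 *: _.
rewrite -{1}(addrK y x); apply: le_trans (enormD _ _) _.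
by rewrite enormN lerD2l; exact: mean_move_le.
Qed.

Lemma drift_le k : drift (th k) <= L / N%:R * enorm (deviation (th k)).
Proof.
have -> : drift (th k) = dot (deviation (th k)) (- (N%:R^-1 *:
    \sum_v td_mean P pi gamma Rw Phi v (th k v))) by rewrite mean_field opprK.
apply: le_trans (dot_le _ _) _; rewrite mulrC ler_wpM2r ?enorm_ge0// enormN enormZ.
rewrite ger0_norm ?invr_ge0 ?ler0n// mulrC ler_wpM2r ?invr_ge0 ?ler0n//.
apply: le_trans (enorm_sum _ _ _) _; apply: ler_sum => v _.
by apply: le_trans (bounded_step v k); rewrite lerDl enorm_ge0.
Qed.

(** The sampled directions average to minus [A] times the deviation plus a
    noise; the projection errors are charged to the disagreement by
    [proj_step_dot]. *)
Lemma deviation_recursion k :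
  dot (deviation (th k.+1)) (deviation (th k.+1)) <=
    dot (deviation (th k)) (deviation (th k)) - 2 * alpha k * drift (th k)
    + 2 * alpha k * noise_term (th k) (s k) (s' k)
    + 2 * alpha k * (L / N%:R) * disagreement (th k)
    + 3 / 2 * alpha k ^+ 2 * (L ^+ 2 / N%:R).
Proof.
rewrite deviationS dot_sqrD; set x := deviation (th k); set q := disagreement (th k).
have a0 := ltW (alpha0 k).
have q0 : 0 <= q by exact: enorm_ge0.
have hmove v : dot x (move k v) <= alpha k * dot x (step k v)
    + alpha k * q * Lv v + alpha k ^+ 2 / 4 * Lv v ^+ 2.
  rewrite /move thS; apply: le_trans (proj_step_dot _ _ _ _ _ _ _ _) _ => //.
    by apply: mix_in => u; exact: td_iter_in.
  rewrite -addrA -[leRHS]addrA lerD2l; apply: lerD.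
    rewrite -mulrA -[leRHS]mulrA ler_wpM2l// mulrC ler_pM ?enorm_ge0 ?step_le//.
    by rewrite enormB; exact: mix_dist_mean_le.
  rewrite mulrAC ler_wpM2l ?divr_ge0 ?sqr_ge0//.
  by rewrite ler_pXn2r ?nnegrE ?enorm_ge0 ?step_le// ltW.
have hcross : dot x (N%:R^-1 *: \sum_v move k v) <= - alpha k * drift (th k)
    + alpha k * noise_term (th k) (s k) (s' k) + alpha k * (L / N%:R) * q
    + alpha k ^+ 2 / 4 * (L ^+ 2 / N%:R).
  rewrite dotZr dot_sumr.
  apply: le_trans (_ : N%:R^-1 * (\sum_v (alpha k * dot x (step k v)
    + alpha k * q * Lv v + alpha k ^+ 2 / 4 * Lv v ^+ 2)) <= _).
    by rewrite ler_wpM2l ?invr_ge0 ?ler0n//; apply: ler_sum => v _; exact: hmove.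
  rewrite !big_split /= -!mulr_sumr.
  have -> : \sum_v dot x (step k v) = \sum_v dot x (td_mean P pi gamma Rw Phi v (th k v))
      + \sum_v dot x (td_noise P pi gamma Rw Phi v (th k v) (s k) (s' k)).
    by rewrite -big_split; apply: eq_bigr => v _; rewrite stepE dotDr.
  rewrite drift_mean /noise_term -/x.
  have h : N%:R^-1 * (alpha k ^+ 2 / 4 * \sum_v Lv v ^+ 2)
      <= alpha k ^+ 2 / 4 * (L ^+ 2 / N%:R).
    rewrite mulrCA ler_wpM2l ?divr_ge0 ?sqr_ge0// mulrC ler_wpM2r ?invr_ge0 ?ler0n//.
    by apply: sum_sqr_le => v; exact: ltW.
  lra.
have hsq : dot (N%:R^-1 *: \sum_v move k v) (N%:R^-1 *: \sum_v move k v)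
    <= alpha k ^+ 2 * (L ^+ 2 / N%:R).
  rewrite -enorm_sqr; apply: le_trans (_ : (alpha k * (L / N%:R)) ^+ 2 <= _).
    rewrite ler_pXn2r ?nnegrE ?enorm_ge0 ?mean_move_le//.
    by rewrite mulr_ge0// divr_ge0// ler0n.
  rewrite exprMn ler_wpM2l ?sqr_ge0// expr_div_n ler_wpM2l ?sqr_ge0//.
  by rewrite lef_pV2 ?posrE ?exprn_gt0// expr2 ler_peMr// ltW.
lra.
Qed.

Section Averages.

Lemma td_weight_sum k : td_weight alpha k = \sum_(t < k) alpha t.
Proof. by elim: k => [|k IH] /=; rewrite ?big_ord0// big_ord_recr /= IH. Qed.

Hypotheses (stP : stationary P pi).

Lemma td_avg_convex k v : td_weight alpha k * value_error (thhat k v)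
  <= \sum_(t < k) alpha t * value_error (th t v).
Proof.
elim: k => [|k IH]; first by rewrite mul0r big_ord0.
have w0 : 0 <= td_weight alpha k.
  by rewrite td_weight_sum sumr_ge0// => t _; exact: ltW.
have w1 : 0 < td_weight alpha k + alpha k by rewrite ltr_wpDl.
rewrite big_ord_recr /=; apply: le_trans (lerD IH (lexx _)).
have := sqnormD_convex stP (Jtilde Phi (thhat k v) - Jtilde Phi thetastar)
  (Jtilde Phi (th k v) - Jtilde Phi thetastar) w0 (ltW (alpha0 k)) w1.
rewrite /value_error; apply: le_trans; rewrite le_eqVlt; apply/orP; left; apply/eqP.
congr (_ * sqnormD _ _); rewrite /Jtilde -scalemxAr mulmxDr -!scalemxAr.
rewrite !scalerBr addrACA -opprD -scalerDl scalerBr [in RHS]scalerA mulVf ?gt_eqF//.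
by rewrite scale1r.
Qed.

(** The bounds at times 0 and 1 thus concern the same error, although nothing
    has been averaged yet at time 0. *)
Lemma td_avg1 v : thhat 1 v = theta0 v.
Proof. by rewrite /= scale0r !add0r scalerA mulVf ?scale1r// gt_eqF. Qed.

End Averages.

Section Disagreement.
Variables (B : nat) (eta : R).
Hypothesis eta0 : 0 <= eta.
Hypothesis mixing : forall k (M : 'M[R]_(N, K)),
  enorm (Wprod W k B *m Q *m M) <= eta * enorm (Q *m M).

Lemma disagreement_le t :
  disagreement (th t) <= eta ^+ (t %/ B) * disagreement theta0
    + L * \sum_(r < t) eta ^+ ((t - r.+1) %/ B) * alpha r.
Proof.
have := consensus_bound N0 dW eta0 mixing (Th := fun t => stack (th t))
  (Pt := fun t => stack (move t)) (c := fun t => alpha t * L).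
move=> /(_ _ _ t); rewrite mulr_sumr.
under [X in _ + X]eq_bigr do rewrite mulrA mulrC.
apply.
  move=> k; rewrite -stack_mix -stackD; congr stack; apply/funext => v.
  by rewrite /move subrKC.
move=> k; apply: le_trans (enorm_le_sum_row _) _; rewrite mulr_sumr.
by apply: ler_sum => v _; rewrite row_stack enorm_tr; exact: move_le.
Qed.

End Disagreement.
End SamplePath.

(** * From the pathwise inequalities to the rates *)

Section Arithmetic.
Variable R : realFieldType.
Implicit Types x rho : R.

Lemma damped_cubic_le x : 0 < x -> x < 1 ->
  (1 - x) * (x + 5 / 7 * x ^+ 2) + 7 / 12 * x ^+ 3 <= 3 / 5.
Proof.
move=> x0 x1; have x2 : x ^+ 2 <= x by rewrite expr2 ler_piMr// ltW.
have q0 : 0 <= 7 / 12 - 5 / 12 * x - 11 / 84 * x ^+ 2 by lra.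
have x1' : 0 <= 1 - x by lra.
by have := mulr_ge0 x1' q0; lra.
Qed.

Lemma young_le c p q : 2 * c * (p * q) <= q ^+ 2 + c ^+ 2 * p ^+ 2 :> R.
Proof. by have := sqr_ge0 (q - c * p); rewrite sqrrB exprMn; lra. Qed.

Lemma sqrt3_bounds x : 0 <= x -> x ^+ 2 = 3 -> 12 / 7 <= x <= 7 / 4.
Proof. by move=> x0 x2; nra. Qed.

Lemma ratio_bounds x y : 7 / 10 <= x <= 5 / 7 ->
  12 / 7 <= y <= 7 / 4 -> 1 <= y / (1 + x) <= 17 / 16.
Proof.
move=> hx hy; have x1 : 0 < 1 + x by lra.
by rewrite ler_pdivlMr// ler_pdivrMr//; lra.
Qed.

Lemma excess_bounds rho x : 1 <= rho -> rho <= 17 / 16 -> 0 <= x ->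
  x <= 5 / 7 -> [/\ rho - 1 + rho * x <= 1, rho * x <= 1
    & 2 * (rho - 1) <= 1].
Proof.
move=> h1 h2 h3 h4.
have : rho * x <= 17 / 16 * (5 / 7) by apply: ler_pM => //; lra.
by move=> h; split; lra.
Qed.

Lemma second_combination (T D0 D1 V1 V2 C C' U0 U1 M D l lc QC BL k2 e2 : R) :
  T <= D0 + D1 + V2 + C -> D0 <= U0 - U1 + M + D + 3 / 2 * l -> D1 <= V1 + e2 ->
  V1 + V2 <= U1 + k2 -> k2 <= l -> e2 <= l -> C <= C' + 4 * lc -> D + C' <= QC ->
  (2 + 3 / 2) * l + 4 * lc <= BL -> T <= U0 + QC + BL + M.
Proof. lra. Qed.

End Arithmetic.

Section Rates.
Variables (R : realType) (B : nat) (NN L c0 g eta : R).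
Hypotheses (B0 : (0 < B)%N) (NN1 : 1 <= NN) (L0 : 0 <= L) (c00 : 0 <= c0)
  (g0 : 0 < g) (eta01 : 0 < eta < 1).

Local Notation delta := (eta `^ B%:R^-1).
Local Notation e t := (eta ^+ (t %/ B)).

Let G : R := (eta * (1 - delta))^-1.

(** What is known along one sample path: [u] is the distance of the mean to the
    optimum, [a] the drift, [q] the disagreement, [m] the noise, [f] and [F] the
    value errors of the iterates and of the averages of one agent, and [Q0] the
    norm of the initial parameters.  The constants [NN], [c0] and [g] stand for
    [N], [sigma_max * R0] and [1 - gamma]. *)
Record path_bounds (alpha u a q m f F : nat -> R) (Q0 : R) : Prop := PathBounds {
  pb_u : forall t, 0 <= u t;
  pb_q : forall t, 0 <= q t;
  pb_q0 : q 0%N <= Q0;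
  pb_recursion : forall t, u t.+1 ^+ 2 <= u t ^+ 2 - 2 * alpha t * a t
    + 2 * alpha t * m t + 2 * alpha t * (L / NN) * q t
    + 3 / 2 * alpha t ^+ 2 * (L ^+ 2 / NN);
  pb_value : forall t, g * f t <= a t + 2 * c0 * q t;
  pb_consensus : forall t, q t <= e t * q 0%N
    + L * \sum_(r < t) e (t - r.+1)%N * alpha r;
  pb_drift : forall t, a t <= L / NN * u t;
  pb_move : forall t, u t <= u t.+1 + alpha t * (L / NN);
  pb_average : forall k, (\sum_(t < k) alpha t) * F k <= \sum_(t < k) alpha t * f t;
  pb_first : F 1%N = F 0%N }.

Let eta0 : 0 < eta. Proof. by case/andP: eta01. Qed.
Let eta1 : eta < 1. Proof. by case/andP: eta01. Qed.

Lemma delta_expB : delta ^+ B = eta.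
Proof.
rewrite -powR_mulrn ?powR_ge0// -powRrM mulVf ?pnatr_eq0 -?lt0n// powRr1//.
exact: ltW.
Qed.

Lemma delta_gt0 : 0 < delta. Proof. exact: powR_gt0. Qed.

Lemma delta_lt1 : delta < 1.
Proof.
rewrite ltNge; apply/negP => d1.
by have := exprn_ege1 B d1; rewrite delta_expB leNgt eta1.
Qed.

Let d0 := delta_gt0.
Let d1 := delta_lt1.

Lemma eta_le_delta : eta <= delta.
Proof.
rewrite -{1}delta_expB; apply: le_trans (_ : delta ^+ 1 <= _); last by rewrite expr1.
by apply: ler_wiXn2l; rewrite ?(ltW d0) ?(ltW d1).
Qed.

Let gap0 : 0 < eta * (1 - delta).
Proof. by rewrite mulr_gt0// subr_gt0. Qed.

Lemma contraction_gap : 4 <= G.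
Proof.
rewrite /G -[4]invrK lef_pV2 ?posrE// ?invr_gt0//.
apply: le_trans (_ : delta * (1 - delta) <= _).
  by rewrite ler_wpM2r ?eta_le_delta// subr_ge0 ltW.
have := sqr_ge0 (delta - 2^-1); lra.
Qed.

Lemma block_rate_le1 t : 0 <= e t <= 1.
Proof. by rewrite exprn_ge0 ?exprn_ile1// ltW. Qed.

(** The last block may be incomplete: [t + 1 <= (t %/ B + 1) * B]. *)
Lemma block_rate_le t : e t * eta <= delta ^+ t.+1.
Proof.
rewrite -exprSr -{1}delta_expB -exprM ler_wiXn2l// ?ltW//.
by rewrite mulnC mulSn addnC {1}(divn_eq t B) ltn_add2l ltn_pmod.
Qed.

Lemma geometric_sum_le k : (1 - delta) * \sum_(t < k) delta ^+ t.+1 = delta - delta ^+ k.+1.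
Proof.
elim: k => [|k IH]; first by rewrite big_ord0 mulr0 expr1 subrr.
by rewrite big_ord_recr mulrDr IH /= !exprS; ring.
Qed.

Lemma block_rate_sum k : \sum_(t < k) e t <= delta * G.
Proof.
rewrite /G ler_pdivlMr// mulrA.
apply: le_trans (_ : (\sum_(t < k) delta ^+ t.+1) * (1 - delta) <= _).
  rewrite ler_wpM2r ?subr_ge0 ?(ltW d1)// mulr_suml.
  by apply: ler_sum => t _; exact: block_rate_le.
by rewrite mulrC geometric_sum_le lerBlDr lerDl exprn_ge0// ltW.
Qed.

Let G0 : 0 < G. Proof. by have := contraction_gap; lra. Qed.

(** Either [delta] is so close to 1 that the right-hand side dominates the
    trivial bound [k] of the sum, or the factor [delta] of the geometric bound
    pays for replacing [k] by [k + 1]. *)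
Lemma block_rate_average k : k.+1%:R * \sum_(t < k) e t <= k%:R * G.
Proof.
have sk : \sum_(t < k) e t <= k%:R.
  rewrite -[leRHS]mulr1 mulr_natl -[X in _ *+ X]card_ord -sumr_const.
  by apply: ler_sum => t _; case/andP: (block_rate_le1 t).
have s0 : 0 <= \sum_(t < k) e t.
  by apply: sumr_ge0 => t _; case/andP: (block_rate_le1 t).
have [h|h] := leP (k.+1%:R * (1 - delta)) 1.
  rewrite mulrC ler_pM//.
  rewrite -[leLHS](mulfK (x := eta * (1 - delta))) ?gt_eqF// -/G ler_piMl ?(ltW G0)//.
  rewrite mulrCA; apply: le_trans h; rewrite -[leRHS]mul1r ler_wpM2r ?(ltW eta1)//.
  by rewrite mulr_ge0// subr_ge0 ltW.
apply: le_trans (_ : k.+1%:R * (delta * G) <= _).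
  by rewrite ler_wpM2l// block_rate_sum.
rewrite mulrA ler_wpM2r ?(ltW G0)//; move: h; rewrite -natr1; lra.
Qed.

Lemma convolution_swap (w : nat -> R) k :
  \sum_(t < k) \sum_(r < t) e (t - r.+1)%N * w r =
  \sum_(r < k) w r * \sum_(m < k - r.+1) e m.
Proof.
elim: k => [|k IH]; first by rewrite !big_ord0.
rewrite !big_ord_recr /= IH subnn big_ord0 mulr0 addr0 -big_split.
apply: eq_bigr => r _ /=; rewrite subSS -(subnSK (ltn_ord r)) big_ord_recr /=.
by rewrite mulrDr [X in _ = _ + X]mulrC.
Qed.

Lemma convolution_le (w : nat -> R) k : (forall r, 0 <= w r) ->
  \sum_(t < k) \sum_(r < t) e (t - r.+1)%N * w r <= delta * G * \sum_(r < k) w r.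
Proof.
move=> w0; rewrite convolution_swap mulr_sumr; apply: ler_sum => r _.
by rewrite mulrC ler_wpM2r// block_rate_sum.
Qed.

Let l2 := L ^+ 2 / NN.
Let lc := L * c0.
Let b := L / NN.
Let NN0 : 0 < NN. Proof. exact: lt_le_trans ltr01 NN1. Qed.
Let b0 : 0 <= b. Proof. by rewrite divr_ge0// ltW. Qed.
Let l20 : 0 <= l2. Proof. by rewrite divr_ge0 ?sqr_ge0// ltW. Qed.
Let lc0 : 0 <= lc. Proof. by rewrite mulr_ge0. Qed.

Let Lb : L * b = l2. Proof. by rewrite /b /l2 mulrA. Qed.

Let bb : b ^+ 2 <= l2.
Proof.
rewrite /b /l2 expr_div_n ler_wpM2l ?sqr_ge0// lef_pV2 ?posrE ?exprn_gt0//.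
by rewrite expr2 ler_peMr// ltW.
Qed.

(** Summation of the recursion; the disagreement created at time [r] is spread
    over the later times with a summable weight, and later step sizes are
    smaller. *)
Lemma path_sum alpha u a q m f F Q0 k : (forall t, 0 < alpha t) ->
  (forall r t, (r <= t)%N -> alpha t <= alpha r) ->
  path_bounds alpha u a q m f F Q0 ->
  2 * g * ((\sum_(t < k) alpha t) * F k) <= u 0%N ^+ 2 + 2 * (\sum_(t < k) alpha t * m t)
   + (2 * b + 4 * c0) * (Q0 * \sum_(t < k) alpha t * e t)
   + ((2 * l2 + 4 * lc) * (delta * G) + 3 / 2 * l2) * \sum_(t < k) alpha t ^+ 2.
Proof.
move=> alpha0 alphaD [u0 q0 q0Q rec val cons drift move avg first].
have tele : u k ^+ 2 + 2 * (\sum_(t < k) alpha t * a t) <= u 0%N ^+ 2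
    + 2 * (\sum_(t < k) alpha t * m t) + 2 * b * (\sum_(t < k) alpha t * q t)
    + 3 / 2 * l2 * \sum_(t < k) alpha t ^+ 2.
  elim: (k) => [|j IH]; first by rewrite !big_ord0; lra.
  rewrite !big_ord_recr /=; have := rec j; rewrite -/b -/l2; lra.
have vsum : g * (\sum_(t < k) alpha t * f t) <=
    \sum_(t < k) alpha t * a t + 2 * c0 * \sum_(t < k) alpha t * q t.
  rewrite !mulr_sumr -big_split; apply: ler_sum => t _ /=.
  rewrite mulrCA [2 * c0 * _]mulrCA -mulrDr ler_wpM2l ?(ltW (alpha0 _))//.
have qsum : \sum_(t < k) alpha t * q t <= Q0 * (\sum_(t < k) alpha t * e t)
    + L * (delta * G * \sum_(t < k) alpha t ^+ 2).
  apply: le_trans (_ : Q0 * (\sum_(t < k) alpha t * e t) + L * \sum_(t < k)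
     \sum_(r < t) e (t - r.+1)%N * alpha r ^+ 2 <= _); last first.
    rewrite lerD2l ler_wpM2l//.
    by apply: (convolution_le (w := fun r => alpha r ^+ 2)) => r; exact: sqr_ge0.
  rewrite !mulr_sumr -big_split; apply: ler_sum => t _ /=.
  have at0 := ltW (alpha0 t).
  apply: le_trans (ler_wpM2l at0 (cons t)) _; rewrite mulrDr; apply: lerD.
    rewrite mulrA mulrC ler_wpM2r//.
    by rewrite mulr_ge0//; case/andP: (block_rate_le1 t).
  rewrite mulrCA ler_wpM2l// mulr_sumr; apply: ler_sum => r _.
  rewrite mulrCA ler_wpM2l//; first by case/andP: (block_rate_le1 (t - r.+1)).
  by rewrite expr2 ler_wpM2r ?(ltW (alpha0 _))// alphaD// ltnW.
have uk := sqr_ge0 (u k).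
have key : 2 * g * ((\sum_(t < k) alpha t) * F k) <=
    u 0%N ^+ 2 + 2 * (\sum_(t < k) alpha t * m t)
    + (2 * b + 4 * c0) * (\sum_(t < k) alpha t * q t)
    + 3 / 2 * l2 * \sum_(t < k) alpha t ^+ 2.
  apply: le_trans (_ : 2 * (g * (\sum_(t < k) alpha t * f t)) <= _).
    by rewrite mulrA ler_wpM2l ?avg// mulr_ge0// ltW.
  lra.
apply: le_trans key _.
have bc : 0 <= 2 * b + 4 * c0 by rewrite addr_ge0// mulr_ge0.
have := ler_wpM2l bc qsum.
have -> : (2 * b + 4 * c0) * (Q0 * (\sum_(t < k) alpha t * e t)
    + L * (delta * G * \sum_(t < k) alpha t ^+ 2)) =
  (2 * b + 4 * c0) * (Q0 * (\sum_(t < k) alpha t * e t)) +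
   (2 * (L * b) + 4 * lc) * (delta * G) * \sum_(t < k) alpha t ^+ 2.
  by rewrite /lc; ring.
rewrite Lb; lra.
Qed.

Let cq := (L + 2 * NN * c0) / (NN * eta * (1 - delta)).
Let beta1 := 4 * L * (L + NN * c0) / (NN * eta * (1 - delta)).

Let cqE : cq = (b + 2 * c0) * G.
Proof.
rewrite /cq /b /G; field; rewrite !gt_eqF// ?subr_gt0//.
Qed.

Let beta1E : beta1 = 4 * (l2 + lc) * G.
Proof.
rewrite /beta1 /l2 /lc /G; field; rewrite !gt_eqF// ?subr_gt0//.
Qed.

Let coef0 : 0 <= 2 * l2 + 4 * lc. Proof. by move: l20 lc0; lra. Qed.

Let bc0 : 0 <= 2 * b + 4 * c0. Proof. by move: b0 c00; lra. Qed.

Let cq0 : 0 <= cq.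
Proof. by rewrite cqE mulr_ge0 ?(ltW G0)//; move: bc0; lra. Qed.

Let steady : (2 * l2 + 4 * lc) * (delta * G) + 3 / 2 * l2 <= beta1.
Proof.
have h := contraction_gap.
have h1 : (2 * l2 + 4 * lc) * (delta * G) <= (2 * l2 + 4 * lc) * G.
  by rewrite ler_wpM2l ?coef0// ler_piMl ?(ltW G0) ?(ltW d1).
have h2 : 3 / 2 * l2 <= 2 * l2 * G.
  by have := mulr_ge0 l20 (ltW G0); have := ler_wpM2l l20 h; lra.
rewrite beta1E; lra.
Qed.

Let beta10 : 0 <= beta1.
Proof. by rewrite beta1E mulr_ge0 ?(ltW G0)//; move: coef0 l20; lra. Qed.

Lemma constant_step_rate (al : R) k : 0 < al -> exists w : nat -> R,
  forall u a q m f F Q0, path_bounds (fun=> al) u a q m f F Q0 ->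
    F k <= (u 0%N ^+ 2 + al * Q0 * ((L + 2 * NN * c0) / (NN * eta * (1 - delta))))
              / (al * g) * k.+1%:R^-1
           + 4 * L * (L + NN * c0) / (NN * eta * (1 - delta)) * al / g
           + \sum_(t < k.+1) w t * m t.
Proof.
rewrite -/cq -/beta1; move=> al0.
have pos_k j : (0 < j)%N -> exists w : nat -> R,
    forall u a q m f F Q0, path_bounds (fun=> al) u a q m f F Q0 ->
    F j <= (u 0%N ^+ 2 + al * Q0 * cq) / (al * g) * j.+1%:R^-1 + beta1 * al / g
           + \sum_(t < j) w t * m t.
  move=> j0; exists (fun=> (g * j%:R)^-1).
  move=> u a q m f F Q0 pb.
  have jR : 0 < j%:R :> R by rewrite ltr0n.
  have jS : 0 < j.+1%:R :> R by rewrite ltr0n.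
  have QQ : 0 <= Q0 by apply: le_trans (pb_q pb 0%N) (pb_q0 pb).
  have := path_sum j (fun=> al0) (fun _ _ _ => lexx _) pb.
  rewrite !sumr_const !card_ord -2!mulr_sumr -[al *+ j]mulr_natl -[al ^+ 2 *+ j]mulr_natl.
  set M := \sum_(t < j) m t; set E := \sum_(t < j) e t => h.
  rewrite -mulr_sumr -/M.
  have D0 : 0 < 2 * g * (j%:R * al) by rewrite !mulr_gt0.
  rewrite -(ler_pM2l D0).
  have -> : 2 * g * (j%:R * al) * F j = 2 * g * (j%:R * al * F j) by ring.
  apply: le_trans h _.
  have -> : 2 * g * (j%:R * al) * ((u 0%N ^+ 2 + al * Q0 * cq) / (al * g) / j.+1%:R
     + beta1 * al / g + (g * j%:R)^-1 * M) =
     u 0%N ^+ 2 * (2 * j%:R / j.+1%:R) + 2 * al * Q0 * cq * (j%:R / j.+1%:R)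
      + 2 * beta1 * (j%:R * al ^+ 2) + 2 * (al * M).
    by field; rewrite !gt_eqF.
  have h1 : u 0%N ^+ 2 <= u 0%N ^+ 2 * (2 * j%:R / j.+1%:R).
    rewrite ler_peMr ?sqr_ge0// ler_pdivlMr// mul1r -natr1.
    have : 1 <= j%:R :> R by rewrite ler1n.
    lra.
  have h2 : (2 * b + 4 * c0) * (Q0 * (al * E)) <= 2 * al * Q0 * cq * (j%:R / j.+1%:R).
    have -> : 2 * al * Q0 * cq * (j%:R / j.+1%:R) =
       (2 * b + 4 * c0) * (Q0 * (al * (G * j%:R / j.+1%:R))) by rewrite cqE; ring.
    rewrite ler_wpM2l ?bc0// ler_wpM2l// ler_wpM2l ?(ltW al0)//.
    by rewrite ler_pdivlMr// mulrC (mulrC G) block_rate_average.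
  have h3 : ((2 * l2 + 4 * lc) * (delta * G) + 3 / 2 * l2) * (j%:R * al ^+ 2)
      <= 2 * beta1 * (j%:R * al ^+ 2).
    apply: ler_wpM2r; first by rewrite mulr_ge0 ?sqr_ge0// ltW.
    by have := steady; have := beta10; lra.
  rewrite (addrAC (u 0%N ^+ 2)) [leLHS]addrAC.
  by apply: lerD => //; apply: lerD => //; exact: lerD.
have [k0|k0] := posnP k; last first.
  have [w hw] := pos_k k k0; exists (fun t => if (t < k)%N then w t else 0).
  move=> u a q m f F Q0 pb; rewrite big_ord_recr /= ltnn mul0r addr0.
  by under eq_bigr do rewrite ltn_ord; exact: hw pb.
(* [F 0 = F 1], and the bound for the latter is the smaller one. *)
have [w hw] := pos_k 1%N isT; rewrite k0; exists w => u a q m f F Q0 pb.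
have QQ : 0 <= Q0 by apply: le_trans (pb_q pb 0%N) (pb_q0 pb).
rewrite -(pb_first pb); apply: le_trans (hw _ _ _ _ _ _ _ pb) _.
rewrite lerD2r lerD2r ler_wpM2l//.
  rewrite divr_ge0 ?mulr_ge0 ?(ltW al0) ?(ltW g0)// addr_ge0 ?sqr_ge0//.
  by rewrite mulr_ge0 ?cq0// mulr_ge0// ltW.
by rewrite lef_pV2 ?posrE// ler_nat.
Qed.

Section InverseSqrt.

Let al (t : nat) : R := (Num.sqrt t.+1%:R)^-1.

Let al0 t : 0 < al t.
Proof. by rewrite invr_gt0 sqrtr_gt0. Qed.

Let al_sqr t : al t ^+ 2 = t.+1%:R^-1.
Proof. by rewrite exprVn sqr_sqrtr. Qed.

Let alD r t : (r <= t)%N -> al t <= al r.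
Proof. by move=> rt; rewrite lef_pV2 ?posrE ?sqrtr_gt0// ler_sqrt// ler_nat. Qed.

Let alK t : al t * Num.sqrt t.+1%:R = 1.
Proof. by rewrite mulVf// gt_eqF// sqrtr_gt0. Qed.

Let al_0 : al 0 = 1. Proof. by rewrite /al sqrtr1 invr1. Qed.

(* Enclosures of [1 / sqrt 2] and [1 / sqrt 3].  The coarse fractions suffice:
   [5 / 7] makes [1 + al 1 <= 12 / 7 <= sqrt 3], and [7 / 12] keeps the cubic of
   [damped_cubic_le] below [3 / 5]. *)
Let al_1 : 7 / 10 <= al 1 <= 5 / 7.
Proof. by have := al_sqr 1; have := al0 1; nra. Qed.

Let al_2 : 4 / 7 <= al 2 <= 7 / 12.
Proof. by have := al_sqr 2; have := al0 2; nra. Qed.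

Let al_3 : al 3 = 1 / 2.
Proof. by have := al_sqr 3; have := al0 3; nra. Qed.

Let S k := \sum_(t < k) al t.

Let S0 k : 0 <= S k. Proof. by apply: sumr_ge0 => t _; exact: ltW. Qed.

Let sqrt_step k : 2 * (Num.sqrt k.+2%:R - Num.sqrt k.+1%:R) <= al k.
Proof.
have x0 : 0 < Num.sqrt k.+1%:R :> R by rewrite sqrtr_gt0.
have xy : Num.sqrt k.+1%:R <= Num.sqrt k.+2%:R :> R by rewrite ler_sqrt// ler_nat.
have x2 : Num.sqrt k.+1%:R ^+ 2 = k.+1%:R :> R by rewrite sqr_sqrtr.
have y2 : Num.sqrt k.+2%:R ^+ 2 = k.+2%:R :> R by rewrite sqr_sqrtr.
rewrite -(ler_pM2r x0) alK; move: x2 y2; rewrite -[k.+2%:R]natr1.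
move: (Num.sqrt _) (Num.sqrt _) x0 xy => x y x0 xy x2 y2; nra.
Qed.

Let step_sum_lower c k : 0 <= c <= 2 -> c * Num.sqrt k.+1%:R <= S k ->
  forall j, (k <= j)%N -> c * Num.sqrt j.+1%:R <= S j.
Proof.
move=> /andP[c_0 c2] base; elim=> [|j IH].
  by rewrite leqn0 => /eqP <-.
rewrite leq_eqVlt => /orP[/eqP <-//|]; rewrite ltnS => /IH {}IH.
rewrite /S big_ord_recr /= -/(S j).
have h := sqrt_step j; have h0 : Num.sqrt j.+1%:R <= Num.sqrt j.+2%:R :> R.
  by rewrite ler_sqrt// ler_nat.
move: (Num.sqrt _) (Num.sqrt _) h h0 IH => x y h h0 IH; nra.
Qed.

Let S3 k : (3 <= k)%N -> Num.sqrt k.+1%:R <= S k.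
Proof.
move=> k3; rewrite -[leLHS]mul1r; apply: (step_sum_lower (k := 3)) => //; first by lra.
rewrite /S !big_ord_recr big_ord0 /= al_0.
have : Num.sqrt 4 = 2 :> R by have := alK 3; rewrite al_3; lra.
by move=> ->; have := al_1; have := al_2; lra.
Qed.

Let S4 k : (4 <= k)%N -> 6 / 5 * Num.sqrt k.+1%:R <= S k.
Proof.
move=> k4; apply: (step_sum_lower (k := 4)) => //; first by lra.
rewrite /S !big_ord_recr big_ord0 /= al_0 al_3.
have s0 : 0 <= Num.sqrt 5%:R :> R by exact: sqrtr_ge0.
have : Num.sqrt 5%:R ^+ 2 = 5 :> R by rewrite sqr_sqrtr.
have := al_1; have := al_2; nra.
Qed.

Let harmonic_le k : \sum_(t < k) al t ^+ 2 <= 1 + ln k.+1%:R.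
Proof.
case: k => [|k]; first by rewrite big_ord0 ln1 addr0.
apply: le_trans (_ : 1 + ln k.+1%:R <= _); last first.
  by rewrite lerD2l ler_ln ?posrE// ler_nat.
elim: k => [|k IH]; first by rewrite big_ord1 al_sqr invr1 ln1 addr0.
rewrite big_ord_recr /= al_sqr; apply: le_trans (lerD IH (lexx _)) _.
rewrite -addrA lerD2l -lerBrDl.
have -> : ln k.+2%:R - ln k.+1%:R = - ln (1 + (- k.+2%:R^-1)) :> R.
  have -> : 1 + - k.+2%:R^-1 = k.+1%:R / k.+2%:R :> R.
    apply: (mulIf (x := k.+2%:R)) => //.
    by rewrite mulrDl mul1r mulNr mulVf// divfK// -[k.+2%:R]natr1 addrK.
  by rewrite ln_div ?posrE// opprB.
rewrite lerNr; apply: le_ln1Dx; rewrite ltrN2.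
by rewrite invf_lt1// ltr1n.
Qed.

(** The steps are 1, [1 / sqrt 2], and then at most [1 / sqrt 3]; with these
    values [1 - delta] times the sum is at most a cubic polynomial in
    [delta]. *)
Let damped_sum_le k : (2 <= k)%N ->
  (1 - delta) * \sum_(t < k) al t * delta ^+ t.+1 <= 3 / 5.
Proof.
move=> k2.
have h : (1 - delta) * \sum_(t < k) al t * delta ^+ t.+1 <=
    (1 - delta) * (delta + 5 / 7 * delta ^+ 2)
    + 7 / 12 * (delta ^+ 3 - delta ^+ k.+1).
  elim: k k2 => [//|k IH]; rewrite leq_eqVlt => /orP[/eqP [<-]|].
    rewrite big_ord_recr big_ord1 /= al_0 mul1r expr1 subrr mulr0 addr0.
    rewrite ler_wpM2l ?subr_ge0 ?(ltW d1)// lerD2l ler_wpM2r ?exprn_ge0 ?(ltW d0)//.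
    by case/andP: al_1.
  rewrite ltnS => k2; have {}IH := IH k2; rewrite big_ord_recr /= mulrDr.
  have a2 : al k <= 7 / 12.
    by apply: le_trans (alD k2) _; case/andP: al_2.
  have p : 0 <= (1 - delta) * delta ^+ k.+1.
    by rewrite mulr_ge0 ?exprn_ge0 ?subr_ge0// ltW.
  have := ler_wpM2r p a2; rewrite [delta ^+ k.+2]exprS; lra.
apply: le_trans h _.
have pk : 0 <= delta ^+ k.+1 by rewrite exprn_ge0// ltW.
apply: le_trans (_ : (1 - delta) * (delta + 5 / 7 * delta ^+ 2)
    + 7 / 12 * delta ^+ 3 <= _); first by lra.
exact: damped_cubic_le d0 d1.
Qed.

(** If [2 sqrt (k + 1) <= G], the trivial bound of the sum by [S k] is enough.
    Otherwise [G >= 4] forces [k >= 4], where [S k] exceeds [sqrt (k + 1)] by the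
    factor [6 / 5] and the sum is at most [3 / 5 * G]. *)
Let weighted_rate_le k : (3 <= k)%N ->
  2 * Num.sqrt k.+1%:R * \sum_(t < k) al t * e t <= S k * G.
Proof.
move=> k3; have r0 : 0 <= Num.sqrt k.+1%:R :> R by exact: sqrtr_ge0.
have sS : \sum_(t < k) al t * e t <= S k.
  apply: ler_sum => t _; rewrite ler_piMr ?(ltW (al0 t))//.
  by case/andP: (block_rate_le1 t).
have [h|h] := leP (2 * Num.sqrt k.+1%:R) G.
  rewrite mulrC ler_pM// ?mulr_ge0//.
  by apply: sumr_ge0 => t _; rewrite mulr_ge0 ?(ltW (al0 t))//; case/andP: (block_rate_le1 t).
have k4 : (4 <= k)%N.
  rewrite ltn_neqAle k3 andbT; apply/eqP => k3'; move: h; rewrite -k3'.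
  have -> : Num.sqrt 4 = 2 :> R by have := alK 3; rewrite al_3; lra.
  by have := contraction_gap; lra.
have sG : \sum_(t < k) al t * e t <= 3 / 5 * G.
  rewrite /G ler_pdivlMr// mulrA mulr_suml mulrC.
  apply: le_trans (damped_sum_le (ltnW (ltnW k4))).
  rewrite ler_wpM2l ?subr_ge0 ?(ltW d1)//; apply: ler_sum => t _.
  by rewrite -mulrA ler_wpM2l ?(ltW (al0 t))// block_rate_le.
apply: le_trans (_ : 2 * Num.sqrt k.+1%:R * (3 / 5 * G) <= _).
  by rewrite ler_wpM2l// mulr_ge0.
have := ler_wpM2r (ltW G0) (S4 k4); lra.
Qed.

(** From [k = 3] on the sum [S k] of the steps is at least [sqrt (k + 1)], so
    that [path_sum] can be rescaled. *)
Let late_rate k : (3 <= k)%N -> exists w : nat -> R,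
  forall u a q m f F Q0, path_bounds al u a q m f F Q0 ->
    F k <= (u 0%N ^+ 2 + Q0 * cq + beta1 * (1 + ln k.+1%:R))
             / (2 * g * Num.sqrt k.+1%:R) + \sum_(t < k) w t * m t.
Proof.
move=> k3; exists (fun t => (g * S k)^-1 * al t) => u a q m f F Q0 pb.
have QQ : 0 <= Q0 by apply: le_trans (pb_q pb 0%N) (pb_q0 pb).
have hs := path_sum k al0 alD pb.
under eq_bigr do rewrite -mulrA.
rewrite -mulr_sumr.
have r0 : 0 < Num.sqrt k.+1%:R :> R by rewrite sqrtr_gt0.
have rS := S3 k3; have wr := weighted_rate_le k3; have hh := harmonic_le k.
have H0 : 0 <= \sum_(t < k) al t ^+ 2 by apply: sumr_ge0 => t _; exact: sqr_ge0.
move: hs; rewrite -/(S k); move: rS wr hh H0 r0.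
move: (Num.sqrt _) (1 + ln _) (\sum_(t < k) al t ^+ 2) (\sum_(t < k) al t * m t)
  (\sum_(t < k) al t * e t) (S k) => r La H M E Sk rS wr hh H0 r0 hs.
have Sk0 : 0 < Sk by exact: lt_le_trans rS.
have h1 : r * u 0%N ^+ 2 <= Sk * u 0%N ^+ 2 by rewrite ler_wpM2r ?sqr_ge0.
have h2 : r * ((2 * b + 4 * c0) * (Q0 * E)) <= Sk * (Q0 * cq).
  have -> : r * ((2 * b + 4 * c0) * (Q0 * E)) = (b + 2 * c0) * Q0 * (2 * r * E) by ring.
  have -> : Sk * (Q0 * cq) = (b + 2 * c0) * Q0 * (Sk * G) by rewrite cqE; ring.
  by rewrite ler_wpM2l// mulr_ge0//; move: bc0; lra.
have h3 : r * (((2 * l2 + 4 * lc) * (delta * G) + 3 / 2 * l2) * H) <= Sk * (beta1 * La).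
  apply: le_trans (_ : r * (beta1 * La) <= _); last first.
    by rewrite ler_wpM2r// mulr_ge0 ?beta10//; exact: le_trans hh.
  rewrite ler_wpM2l ?(ltW r0)//; apply: le_trans (_ : beta1 * H <= _).
    by rewrite ler_wpM2r ?steady.
  by rewrite ler_wpM2l ?beta10.
have D0 : 0 < 2 * g * Sk * r by rewrite !mulr_gt0.
rewrite -(ler_pM2l D0).
have -> : 2 * g * Sk * r * ((u 0%N ^+ 2 + Q0 * cq + beta1 * La) / (2 * g * r)
    + (g * Sk)^-1 * M) =
    Sk * u 0%N ^+ 2 + Sk * (Q0 * cq) + Sk * (beta1 * La) + 2 * r * M.
  by field; rewrite !gt_eqF.
have -> : 2 * g * Sk * r * F k = r * (2 * g * (Sk * F k)) by ring.
apply: le_trans (ler_wpM2l (ltW r0) hs) _.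
rewrite !mulrDr in h3 *; rewrite -/cq in h2 *.
have := lerD (lerD h1 h2) h3; lra.
Qed.

(** Up to [k = 1] the average is the initial parameter.  The drift there is at
    most [b * u 0], which Young's inequality turns into the square distance with
    the weight [sqrt (k + 1)] that the rate asks for. *)
Let early_rate k : (k <= 1)%N ->
  forall u a q m f F Q0, path_bounds al u a q m f F Q0 ->
    F k <= (u 0%N ^+ 2 + Q0 * cq + beta1 * (1 + ln k.+1%:R))
             / (2 * g * Num.sqrt k.+1%:R).
Proof.
move=> k1 u a q m f F Q0 pb; case: (pb) => u0 q0 q0Q _ val _ drift _ avg first.
have Fk : F k <= f 0%N.
  have : F 1%N <= f 0%N by have := avg 1%N; rewrite !big_ord1 al_0 !mul1r.
  by move: k1; case: (k) => [|[|//]] _; rewrite ?first.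
have r0 : 0 < Num.sqrt k.+1%:R :> R by rewrite sqrtr_gt0.
have r2 : Num.sqrt k.+1%:R ^+ 2 <= 2 :> R.
  by rewrite sqr_sqrtr// ler_nat ltnS.
have L1 : 1 <= 1 + ln k.+1%:R :> R.
  by rewrite lerDl ln_ge0// ler1n.
move: r0 r2 L1; move: (Num.sqrt _) (1 + ln _) => r La r0 r2 L1.
have rr : r <= 3 / 2 by nra.
have D0 : 0 < 2 * g * r by rewrite !mulr_gt0.
rewrite ler_pdivlMr// mulrC.
apply: le_trans (_ : 2 * r * (g * f 0%N) <= _).
  have -> : 2 * g * r * F k = 2 * r * (g * F k) by ring.
  apply: ler_wpM2l; first by rewrite mulr_ge0// ltW.
  by rewrite ler_wpM2l// ltW.
have h1 := val 0%N; have h2 := drift 0%N; rewrite -/b in h2.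
have h3 : 2 * r * (b * u 0%N) <= u 0%N ^+ 2 + r ^+ 2 * b ^+ 2.
  exact: young_le.
have h4 : r ^+ 2 * b ^+ 2 <= 2 * l2.
  by apply: ler_pM => //; rewrite ?sqr_ge0 ?bb.
have h5 : 2 * r * (2 * c0 * q 0%N) <= Q0 * cq.
  rewrite cqE.
  have -> : 2 * r * (2 * c0 * q 0%N) = q 0%N * (4 * r * c0) by ring.
  rewrite ler_pM ?mulr_ge0 ?(ltW r0)//.
  apply: le_trans (_ : (b + 2 * c0) * 4 <= _); last first.
    by rewrite ler_wpM2l ?contraction_gap//; move: bc0; lra.
  by have := ler_wpM2r c00 rr; move: (b) b0 c00 => b' b0' c00'; lra.
have h6 : 2 * l2 <= beta1 * La.
  apply: le_trans (_ : beta1 * 1 <= _); last by rewrite ler_wpM2l ?beta10.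
  rewrite mulr1 beta1E; have := ler_wpM2l l20 contraction_gap.
  by have := mulr_ge0 lc0 (ltW G0); move: l20; lra.
have r2p : 0 <= 2 * r by rewrite mulr_ge0// ltW.
have := ler_wpM2l r2p h1; have := ler_wpM2l r2p h2.
move: h3 h4 h5 h6; move: (Q0 * cq) (beta1 * La) => QC BL; lra.
Qed.

(** At [k = 2] the factor [sqrt 3 / (1 + 1 / sqrt 2)] slightly exceeds 1.  The
    excess of drift at time 0 and the drift at time 1 are absorbed by the square
    distance at time 1, instead of using the recursion for the latter. *)
Let second_rate : exists w : nat -> R,
  forall u a q m f F Q0, path_bounds al u a q m f F Q0 ->
    F 2%N <= (u 0%N ^+ 2 + Q0 * cq + beta1 * (1 + ln 3%:R))
             / (2 * g * Num.sqrt 3%:R) + w 0%N * m 0%N.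
Proof.
pose r : R := Num.sqrt 3%:R.
have r0 : 0 < r by rewrite sqrtr_gt0.
exists (fun=> (g * r)^-1) => u a q m f F Q0 pb.
case: (pb) => u0 q0 q0Q rec val cons drift move avg first.
have QQ : 0 <= Q0 by exact: le_trans (q0 _) q0Q.
have L1 : 1 <= 1 + ln 3%:R :> R by rewrite lerDl ln_ge0// ler1n.
rewrite -/r; move: L1; move: (1 + ln _) => La L1.
have r2 : r ^+ 2 = 3 by rewrite sqr_sqrtr.
have rb := sqrt3_bounds (ltW r0) r2; have [_ rr] := andP rb.
pose x := al 1; have x0 : 0 <= x := ltW (al0 1).
have [_ xu] : _ /\ x <= 5 / 7 := andP al_1.
pose rho := r / (1 + x).
have x1 : 0 < 1 + x by rewrite ltr_pwDl.
have rhoE : rho * (1 + x) = r by rewrite /rho divfK// gt_eqF.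
have [rho1 rho2] : 1 <= rho /\ rho <= 17 / 16 := andP (ratio_bounds al_1 rb).
clearbody rho.
have rho0 : 0 <= rho := le_trans ler01 rho1.
have hF : r * F 2%N <= rho * f 0%N + rho * x * f 1%N.
  have := avg 2%N; rewrite !big_ord_recr !big_ord0 /= al_0 !add0r !mul1r -/x => h.
  by have := ler_wpM2l rho0 h; rewrite mulrA rhoE mulrDr mulrA.
clearbody x.
have D0 : 0 < 2 * g * r by rewrite !mulr_gt0.
rewrite -(ler_pM2l D0).
have -> : 2 * g * r * ((u 0%N ^+ 2 + Q0 * cq + beta1 * La) / (2 * g * r)
    + (g * r)^-1 * m 0%N) = u 0%N ^+ 2 + Q0 * cq + beta1 * La + 2 * m 0%N.
  by field; rewrite !gt_eqF.
have hv0 : 2 * rho * (g * f 0%N) <= 2 * rho * (a 0%N + 2 * c0 * q 0%N).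
  by rewrite ler_wpM2l// mulr_ge0.
have hv1 : 2 * (rho * x) * (g * f 1%N) <= 2 * (rho * x) * (b * u 1%N + 2 * c0 * q 1%N).
  apply: ler_wpM2l; first by rewrite !mulr_ge0.
  apply: le_trans (val 1%N) _.
  by rewrite lerD2r; exact: drift.
have hrec := rec 0%N; rewrite al_0 expr1n -/b -/l2 in hrec.
have hd0 : a 0%N <= b * (u 1%N + b).
  apply: le_trans (drift 0%N) _; rewrite -/b ler_wpM2l//.
  by have := move 0%N; rewrite al_0 mul1r.
have hq1 : q 1%N <= q 0%N + L.
  apply: le_trans (cons 1%N) _; rewrite big_ord1 subnn div0n expr0 al_0 mul1r mulr1 lerD2r.
  by rewrite ler_piMl//; case/andP: (block_rate_le1 1).
have [kap1 rx1 rho3] := excess_bounds rho1 rho2 x0 xu.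
have rx : 0 <= rho * x by rewrite mulr_ge0.
have rho1' : 0 <= rho - 1 by rewrite subr_ge0.
have hk2 : (rho - 1 + rho * x) ^+ 2 * b ^+ 2 <= 1 * l2.
  by apply: ler_pM; rewrite ?sqr_ge0 ?bb// expr_le1// addr_ge0.
have hexc : 2 * (rho - 1) * a 0%N <= 2 * (rho - 1) * (b * (u 1%N + b)).
  by rewrite ler_wpM2l// mulr_ge0.
have hb2 : 2 * (rho - 1) * b ^+ 2 <= 1 * l2.
  apply: ler_pM; rewrite ?sqr_ge0 ?bb ?mulr_ge0//.
have hc : 2 * rho * (2 * c0 * q 0%N) + 2 * (rho * x) * (2 * c0 * q 1%N)
    <= 4 * r * (c0 * q 0%N) + 4 * lc.
  have p1 : 0 <= 4 * (rho * x) * c0 by rewrite !mulr_ge0.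
  have := ler_wpM2l p1 hq1; have := ler_wpM2r lc0 rx1; rewrite /lc -rhoE; lra.
have hQ : 2 * b * q 0%N + 4 * r * (c0 * q 0%N) <= Q0 * cq.
  apply: le_trans (_ : q 0%N * ((b + 2 * c0) * 4) <= _).
    have p1 : 0 <= c0 * q 0%N by rewrite mulr_ge0.
    have p2 : 0 <= b * q 0%N by rewrite mulr_ge0.
    by have := ler_wpM2r p1 rr; move: p1 p2; lra.
  rewrite cqE ler_pM//; first by rewrite mulr_ge0//; move: bc0; lra.
  by rewrite ler_wpM2l ?contraction_gap//; move: bc0; lra.
have hb1 : (2 + 3 / 2) * l2 + 4 * lc <= beta1 * La.
  apply: le_trans (_ : beta1 * 1 <= _); last by rewrite ler_wpM2l ?beta10.
  rewrite mulr1 beta1E; have := ler_wpM2l l20 contraction_gap.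
  by have := ler_wpM2l lc0 contraction_gap; move: l20 lc0; lra.
have g2 : 0 <= 2 * g by rewrite mulr_ge0// ltW.
rewrite !mul1r in hk2 hb2.
apply: (second_combination (D0 := 2 * a 0%N) (D1 := 2 * (rho - 1) * a 0%N)
  (V1 := 2 * (rho - 1) * (b * u 1%N)) (V2 := 2 * (rho * x) * (b * u 1%N))
  (C := 2 * rho * (2 * c0 * q 0%N) + 2 * (rho * x) * (2 * c0 * q 1%N))
  (C' := 4 * r * (c0 * q 0%N)) (U1 := u 1%N ^+ 2) (D := 2 * b * q 0%N)
  _ _ _ _ hk2 hb2 hc hQ hb1).
- have -> : 2 * g * r * F 2%N = 2 * g * (r * F 2%N) by ring.
  apply: le_trans (ler_wpM2l g2 hF) _.
  have -> : 2 * g * (rho * f 0%N + rho * x * f 1%N) =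
    2 * rho * (g * f 0%N) + 2 * (rho * x) * (g * f 1%N) by ring.
  apply: le_trans (lerD hv0 hv1) _; rewrite le_eqVlt; apply/orP; left; apply/eqP; ring.
- by move: hrec; lra.
- by apply: le_trans hexc _; rewrite (mulrDr b) mulrDr expr2.
- rewrite -mulrDl -mulrDr; exact: young_le.
Qed.

Lemma inverse_sqrt_step_rate k : exists w : nat -> R,
  forall u a q m f F Q0,
    path_bounds (fun t => (Num.sqrt t.+1%:R)^-1) u a q m f F Q0 ->
    F k <= (u 0%N ^+ 2 + Q0 * ((L + 2 * NN * c0) / (NN * eta * (1 - delta)))
            + 4 * L * (L + NN * c0) / (NN * eta * (1 - delta)) * (1 + ln k.+1%:R))
             / (2 * g * Num.sqrt k.+1%:R) + \sum_(t < k.+1) w t * m t.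
Proof.
rewrite -/cq -/beta1.
have [k3|] := leqP 3 k.
  have [w hw] := late_rate k3; exists (fun t => if (t < k)%N then w t else 0).
  move=> u a q m f F Q0 pb; rewrite big_ord_recr /= ltnn mul0r addr0.
  by under eq_bigr do rewrite ltn_ord; exact: hw pb.
rewrite ltnS leq_eqVlt => /orP[/eqP ->|k1].
  have [w hw] := second_rate; exists (fun t => if t == 0%N then w 0%N else 0).
  move=> u a q m f F Q0 pb; rewrite !big_ord_recr big_ord0 /= !mul0r !addr0 add0r.
  exact: hw pb.
exists (fun=> 0) => u a q m f F Q0 pb.
under eq_bigr do rewrite mul0r.
by rewrite big1 ?addr0//; apply: (early_rate k1 pb).
Qed.

End InverseSqrt.

End Rates.

(** * Bounded measurable functions and their expectations *)

Section BoundedMeasurable.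
Variables (d : measure_display) (T : measurableType d) (R : realType).
Implicit Types f g : T -> R.

Definition bounded_mfun f :=
  measurable_fun setT f /\ exists M : R, forall w, `|f w| <= M.

Lemma bounded_mfun_cst c : bounded_mfun (fun=> c).
Proof. by split; [exact: measurable_cst|exists `|c|]. Qed.

Lemma bounded_mfunD f g : bounded_mfun f -> bounded_mfun g ->
  bounded_mfun (fun w => f w + g w).
Proof.
move=> [mf [M hM]] [mg [M' hM']]; split; first exact: measurable_funD.
by exists (M + M') => w; apply: le_trans (ler_normD _ _) _; exact: lerD.
Qed.

Lemma bounded_mfunM f g : bounded_mfun f -> bounded_mfun g ->
  bounded_mfun (fun w => f w * g w).
Proof.
move=> [mf [M hM]] [mg [M' hM']]; split; first exact: measurable_funM.
by exists (M * M') => w; rewrite normrM; exact: ler_pM.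
Qed.

Lemma bounded_mfunZ c f : bounded_mfun f -> bounded_mfun (fun w => c * f w).
Proof. by apply: bounded_mfunM; exact: bounded_mfun_cst. Qed.

Lemma bounded_mfunB f g : bounded_mfun f -> bounded_mfun g ->
  bounded_mfun (fun w => f w - g w).
Proof.
move=> bf bg; apply: bounded_mfunD => //.
have -> : (fun w => - g w) = (fun w => -1 * g w) by apply/funext => w; rewrite mulN1r.
exact: bounded_mfunZ.
Qed.

Lemma bounded_mfun_sum (I : Type) (r : seq I) (F : I -> T -> R) :
  (forall i, bounded_mfun (F i)) -> bounded_mfun (fun w => \sum_(i <- r) F i w).
Proof.
move=> bF; elim: r => [|i r IH].
  by under eq_fun do rewrite big_nil; exact: bounded_mfun_cst.
by under eq_fun do rewrite big_cons; exact: bounded_mfunD.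
Qed.

Lemma bounded_mfun_indic (A : set T) : measurable A -> bounded_mfun \1_A.
Proof.
move=> mA; split; first exact: measurable_indic.
by exists 1 => w; rewrite indicE normr_nat; case: (w \in A).
Qed.

(** The function is the sum of its sections, each multiplied by the indicator of
    an event. *)
Lemma measurable_fun_finite_case (I : finType) (c : T -> I) (F : I -> T -> R) :
  (forall i, measurable [set w | c w = i]) ->
  (forall i, measurable_fun setT (F i)) ->
  measurable_fun setT (fun w => F (c w) w).
Proof.
move=> mc mF.
have -> : (fun w => F (c w) w) =
    (fun w => \sum_i F i w * \1_[set w | c w = i] w).
  apply/funext => w; rewrite (bigD1 (c w))//= indicE mem_set// mulr1.
  rewrite big1 ?addr0// => i ic; rewrite indicE memNset ?mulr0//=.
  by move=> cw; rewrite cw eqxx in ic.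
by apply: measurable_sum => i; exact: measurable_funM.
Qed.

Lemma measurable_fun_sqrt f : measurable_fun setT f ->
  measurable_fun setT (fun w => Num.sqrt (f w)).
Proof.
move=> mf; apply: (@measurableT_comp _ _ _ _ _ _ (@Num.sqrt R)) => //.
apply: continuous_measurable_fun; exact: sqrt_continuous.
Qed.

Lemma measurable_fun_enorm m n (u : T -> 'M[R]_(m, n)) :
  (forall i j, measurable_fun setT (fun w => u w i j)) ->
  measurable_fun setT (fun w => enorm (u w)).
Proof.
move=> mu; apply: measurable_fun_sqrt; apply: measurable_sum => i.
by apply: measurable_sum => j; exact: measurable_funX.
Qed.

(** For a Lipschitz [f], the condition [f x < a] holds iff it is witnessed at
    some rational point near [x], by [f q + c |x - q| < a]: a countable union of
    conditions on the coordinates of [x]. *)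
Lemma measurable_fun_lipschitz K (f : 'cV[R]_K -> R) (c : R) (u : T -> 'cV[R]_K) :
  0 <= c -> (forall x y, `|f x - f y| <= c * enorm (x - y)) ->
  (forall l, measurable_fun setT (fun w => u w l 0)) ->
  measurable_fun setT (fun w => f (u w)).
Proof.
move=> c0 lip mu; apply: (measurability _ (RGenInftyO.measurableE R)) => //.
move=> _ [_ [a ->] <-]; rewrite setTI.
pose q (z : {ffun 'I_K -> rat}) : 'cV[R]_K := \col_l ratr (z l).
have -> : (fun w => f (u w)) @^-1` `]-oo, a[ =
    \bigcup_z [set w | f (q z) + c * enorm (u w - q z) < a].
  apply/seteqP; split=> w /=; rewrite ?in_itv/=; last first.
    move=> [z _ /=]; apply: le_lt_trans.
    by have := lip (u w) (q z); rewrite ler_norml; lra.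
  move=> fa; pose e := (a - f (u w)) / (2 * c * K%:R + 1).
  have D0 : 0 < 2 * c * K%:R + 1 by rewrite ltr_wpDl// !mulr_ge0.
  have e0 : 0 < e by rewrite divr_gt0// subr_gt0.
  have /fin_all_exists[z hz] : forall l, exists r : rat, `|u w l 0 - ratr r| < e.
    move=> l; have /rat_in_itvoo[r] : u w l 0 - e < u w l 0 + e by lra.
    rewrite in_itv/= => hr; exists r; rewrite ltr_norml; lra.
  exists [ffun l => z l] => //=; set y := q _.
  have hy : enorm (u w - y) <= K%:R * e.
    apply: le_trans (enorm_le_sum_row _) _.
    apply: le_trans (_ : \sum_(i < K) e <= _); last first.
      by rewrite sumr_const card_ord mulr_natl.
    apply: ler_sum => i _; rewrite enorm_le ?(ltW e0)// /dot !big_ord1 !mxE ffunE -expr2.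
    by rewrite -real_normK ?num_real// ler_pXn2r ?nnegrE ?(ltW e0)// ltW.
  have := lip (u w) y; rewrite ler_norml => /andP[h _].
  have h1 : c * enorm (u w - y) <= c * (K%:R * e) by rewrite ler_wpM2l.
  have h2 : e * (2 * c * K%:R + 1) = a - f (u w) by rewrite /e divfK// gt_eqF.
  by move: h h1 h2 e0 => h h1 h2 e0; lra.
apply: countable_bigcupT_measurable => [|z]; first exact: countableP.
rewrite -[X in measurable X]setTI.
apply: (measurable_fun_ltr _ (measurable_cst a)) => //.
apply: measurable_funD; first exact: measurable_cst.
apply: measurable_funM; first exact: measurable_cst.
apply: measurable_fun_enorm => i j; rewrite ord1.
under eq_fun do rewrite !mxE.
by apply: measurable_funB => //; exact: measurable_cst.
Qed.

End BoundedMeasurable.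

(** * Measurability of the iterates *)

Section Iterates.
Variables (R : realType) (N n K : nat) (P : 'M[R]_n) (pi : 'rV[R]_n) (gamma : R).
Variables (Rw : 'I_N -> 'I_n -> 'I_n -> R) (Phi : 'M[R]_(n, K)).
Variables (W : nat -> 'M[R]_N) (X : set 'cV[R]_K) (thetastar : 'cV[R]_K).
Variable alpha : nat -> R.
Hypotheses (cX : convex_set (X : set (convex_lmodType 'cV[R]_K)))
  (kX : compact X) (Xstar : X thetastar).

Local Notation iter theta0 s s' := (td_iter gamma Rw Phi X W alpha theta0 s s').

Lemma td_iter_ext k theta0 (s1 s1' s2 s2' : nat -> 'I_n) :
  (forall t, (t < k)%N -> s1 t = s2 t /\ s1' t = s2' t) ->
  iter theta0 s1 s1' k = iter theta0 s2 s2' k.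
Proof.
elim: k => //= k IH h.
rewrite IH; last by move=> t tk; apply: h; exact: ltnW.
by have [-> ->] := h k (ltnSn k).
Qed.

Section Measurable.
Variables (d : measure_display) (T : measurableType d).
Variables (theta0 : 'I_N -> T -> 'cV[R]_K) (s s' : nat -> T -> 'I_n).
Hypothesis mtheta0 : forall v l, measurable_fun setT (fun w => theta0 v w l 0).
Hypothesis ms : forall k i j, measurable [set w | s k w = i /\ s' k w = j].
Hypothesis Xtheta0 : forall v w, X (theta0 v w).

Local Notation th k w := (iter (theta0 ^~ w) (s ^~ w) (s' ^~ w) k).

Lemma measurable_fun_sample k (F : 'I_n -> 'I_n -> T -> R) :
  (forall i j, measurable_fun setT (F i j)) ->
  measurable_fun setT (fun w => F (s k w) (s' k w) w).
Proof.
move=> mF; apply: (@measurable_fun_finite_case _ T R _ (fun w => (s k w, s' k w))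
  (fun ij w => F ij.1 ij.2 w)) => [[i j]|[i j]]; last exact: mF.
rewrite [X in measurable X](_ : _ = [set w | s k w = i /\ s' k w = j])//.
by apply/seteqP; split => w /= [-> ->].
Qed.

Lemma td_iter_measurable k v l : measurable_fun setT (fun w => th k w v l 0).
Proof.
elim: k v l => [|k IH] v l /=; first exact: mtheta0.
apply: (@measurable_fun_lipschitz _ T R K
  (fun y => proj_on (@enorm R K 1) X y l 0) 1) => //.
  move=> x y; rewrite mul1r; apply: le_trans (_ : enorm (proj_on (@enorm R K 1) X x
    - proj_on (@enorm R K 1) X y) <= _).
    have := coord_le_enorm (proj_on (@enorm R K 1) X x - proj_on (@enorm R K 1) X y) l 0.
    by rewrite !mxE.
  by apply: proj_on_nonexpansive => //; exists thetastar.
move=> i; under eq_fun do rewrite mxE summxE.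
apply: measurable_funD.
  apply: measurable_sum => u; under eq_fun do rewrite mxE.
  by apply: measurable_funM.
under eq_fun do rewrite mxE.
apply: (@measurable_fun_sample k (fun a b w => alpha k * td_error gamma Rw Phi v
  (th k w v) a b * phi Phi a i 0)) => a b.
apply: measurable_funM => //; apply: measurable_funM => //.
rewrite /td_error; apply: measurable_funD => //.
under eq_fun do rewrite mxE.
apply: measurable_sum => j; under eq_fun do rewrite mxE.
by apply: measurable_funM.
Qed.

Lemma td_iter_bounded_mfun k v l : bounded_mfun (fun w => th k w v l 0).
Proof.
split; first exact: td_iter_measurable.
have [M hM] := compact_enorm_bounded 0 kX (ex_intro _ _ Xstar).
exists M => w; apply: le_trans (coord_le_enorm _ _ _) _.
have := hM (th k w v); rewrite sub0r enormN; apply.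
exact: (td_iter_in _ _ _ _ _ kX Xstar).
Qed.

End Measurable.

Section Observables.
Variables (d : measure_display) (T : measurableType d).
Variable th : T -> 'I_N -> 'cV[R]_K.
Hypothesis bth : forall v l, bounded_mfun (fun w => th w v l 0).

Lemma bounded_mfun_dot m p (u v : T -> 'M[R]_(m, p)) :
  (forall i j, bounded_mfun (fun w => u w i j)) ->
  (forall i j, bounded_mfun (fun w => v w i j)) ->
  bounded_mfun (fun w => dot (u w) (v w)).
Proof.
move=> bu bv; apply: bounded_mfun_sum => i; apply: bounded_mfun_sum => j.
exact: bounded_mfunM.
Qed.

Lemma bounded_mfun_enorm m p (u : T -> 'M[R]_(m, p)) :
  (forall i j, bounded_mfun (fun w => u w i j)) -> bounded_mfun (fun w => enorm (u w)).
Proof.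
move=> bu; split; first by apply: measurable_fun_enorm => i j; case: (bu i j).
have [_ [M hM]] := bounded_mfun_dot bu bu.
exists (M + 1) => w; rewrite ger0_norm ?enorm_ge0//.
have M0 : 0 <= M by apply: le_trans (hM w).
rewrite enorm_le ?addr_ge0//; apply: le_trans (ler_norm _) _; apply: le_trans (hM w) _.
by rewrite sqrrD expr1n mulr1 -addrA; have := sqr_ge0 M; lra.
Qed.

Lemma bounded_mfun_deviation i j : bounded_mfun (fun w => deviation thetastar (th w) i j).
Proof.
rewrite ord1; under eq_fun do rewrite !mxE summxE.
apply: bounded_mfunB; last exact: bounded_mfun_cst.
by apply: bounded_mfunZ; exact: bounded_mfun_sum.
Qed.

Lemma bounded_mfun_mulmx m p (A : 'M[R]_(m, p)) (u : T -> 'cV[R]_p) i j :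
  (forall i, bounded_mfun (fun w => u w i 0)) ->
  bounded_mfun (fun w => (A *m u w) i j).
Proof.
move=> bu; rewrite ord1; under eq_fun do rewrite mxE.
by apply: bounded_mfun_sum => k; exact: bounded_mfunZ.
Qed.

Lemma bounded_mfun_noise i j :
  bounded_mfun (fun w => noise_term P pi gamma Rw Phi thetastar (th w) i j).
Proof.
apply: bounded_mfunZ; apply: bounded_mfun_sum => v; apply: bounded_mfun_dot.
  exact: bounded_mfun_deviation.
move=> a b; rewrite ord1 /td_noise; under eq_fun do rewrite mxE [X in X + _]mxE [X in _ + X]mxE.
apply: bounded_mfunB.
  under eq_fun do rewrite mulrC.
  apply: bounded_mfunZ; apply: bounded_mfunD; first exact: bounded_mfun_cst.
  under eq_fun do rewrite dot_mxE dotC.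
  apply: bounded_mfun_dot => k l; first exact: bounded_mfun_cst.
  by rewrite ord1.
rewrite /td_mean; under eq_fun do rewrite mxE [X in _ + X]mxE.
apply: bounded_mfunB; first exact: bounded_mfun_cst.
exact: bounded_mfun_mulmx.
Qed.

End Observables.
End Iterates.

(** * Expectation of the noise *)

Section Expectation.
Variables (d : measure_display) (T : measurableType d) (R : realType).
Variable Pr : probability T R.
Implicit Types f g : T -> R.

Local Notation E f := (\int[Pr]_w f w).

Lemma bounded_mfun_integrable f : bounded_mfun f -> Pr.-integrable setT (EFin \o f).
Proof.
move=> [mf [M hM]]; apply: measurable_bounded_integrable => //.
  by rewrite ltey_eq fin_num_measure.
exists M; split; first exact: num_real.
by move=> x Mx w _; apply: le_trans (hM w) (ltW Mx).
Qed.

Lemma expectE f : bounded_mfun f -> ('E_Pr[f] = (E f)%:E)%E.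
Proof.
move=> bf; rewrite unlock fineK//; apply: integrable_fin_num => //.
exact: bounded_mfun_integrable.
Qed.

Lemma expectD f g : bounded_mfun f -> bounded_mfun g ->
  \int[Pr]_w (f w + g w) = E f + E g.
Proof. by move=> bf bg; apply: RintegralD => //; exact: bounded_mfun_integrable. Qed.

Lemma expectZ c f : bounded_mfun f -> \int[Pr]_w (c * f w) = c * E f.
Proof. by move=> bf; apply: RintegralZl => //; exact: bounded_mfun_integrable. Qed.

Lemma expect_cst c : \int[Pr]_w c = c :> R.
Proof.
rewrite Rintegral_cst// (_ : (Pr : {measure set T -> \bar R}) setT = 1%E) ?mulr1//.
exact: probability_setT.
Qed.

Lemma expect_sum (I : Type) (r : seq I) (F : I -> T -> R) :
  (forall i, bounded_mfun (F i)) ->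
  \int[Pr]_w (\sum_(i <- r) F i w) = \sum_(i <- r) E (F i).
Proof.
move=> bF; elim: r => [|i r IH].
  by rewrite big_nil; under eq_Rintegral do rewrite big_nil; exact: expect_cst.
rewrite big_cons; under eq_Rintegral do rewrite big_cons.
by rewrite expectD ?IH//; exact: bounded_mfun_sum.
Qed.

(** For [f >= 0], integrate over [r] the hypothesis for the tails
    [Y = ]r, +oo[ ]; a bounded [f] becomes nonnegative by adding a constant. *)
Lemma expect_independent (C : set T) (p : R) f : measurable C -> 0 <= p ->
  bounded_mfun f ->
  (forall Y : set R, measurable Y -> Pr (C `&` f @^-1` Y) = (p%:E * Pr (f @^-1` Y))%E) ->
  \int[Pr]_w (\1_C w * f w) = p * E f.
Proof.
move=> mC p0 bf ind; have [mf [M hM]] := bf.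
pose g w := f w + M.
have g0 w : 0 <= g w by have := hM w; rewrite ler_norml /g; lra.
have bg : bounded_mfun g by apply: bounded_mfunD => //; exact: bounded_mfun_cst.
have bC := bounded_mfun_indic R mC.
have bCg : bounded_mfun (fun w => \1_C w * g w) by exact: bounded_mfunM.
pose gm : {RV Pr >-> R} := HB.pack g (isMeasurableFun.Build _ _ _ _ _ bg.1).
pose Cgm : {RV Pr >-> R} := HB.pack (fun w => \1_C w * g w)
  (isMeasurableFun.Build _ _ _ _ _ bCg.1).
have key : \int[Pr]_w (\1_C w * g w) = p * E g.
  apply: EFin_inj; rewrite EFinM -!expectE//.
  rewrite -[LHS]/('E_Pr[Cgm])%E -['E_Pr[g]%E]/('E_Pr[gm])%E.
  rewrite !ge0_expectation_ccdf//; last by move=> w; rewrite mulr_ge0// indicE ler0n.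
  rewrite -ge0_integralZl//; last first.
    - exact: measurable_funTS (ccdf_measurable _).
  apply: eq_integral => r; rewrite inE/= in_itv/= andbT => r0.
  rewrite /ccdf /distribution /pushforward /=.
  have -> : (fun w => \1_C w * g w) @^-1` `]r, +oo[ = C `&` f @^-1` `](r - M), +oo[.
    apply/seteqP; split => w /=; rewrite !in_itv/= !andbT.
      have [wC|wC] := pselect (C w).
        by rewrite indicE mem_set// mul1r /g => h; split => //; lra.
      by rewrite indicE memNset// mul0r ltNge r0.
    by move=> [wC h]; rewrite indicE mem_set// mul1r /g; lra.
  rewrite ind//; congr (_ * Pr _)%E; apply/seteqP; split => w /=.
    by rewrite !in_itv/= !andbT /g; lra.
  by rewrite !in_itv/= !andbT /g; lra.
have E1 : \int[Pr]_w (\1_C w) = p.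
  apply: EFin_inj; rewrite -expectE// expectation_indic//.
  have := ind setT measurableT; rewrite preimage_setT setIT => ->.
  by rewrite probability_setT mule1.
move: key; rewrite /g; under eq_Rintegral do rewrite mulrDr [X in _ + X]mulrC.
rewrite !expectD//; [|exact: bounded_mfunM|exact: bounded_mfunZ|exact: bounded_mfun_cst].
by rewrite expectZ// E1 expect_cst; lra.
Qed.

End Expectation.

Lemma measurable_set_cst (d : measure_display) (T : measurableType d) (Q : Prop) :
  measurable ([set _ | Q] : set T).
Proof.
have [q|nq] := pselect Q.
  have -> : [set _ : T | Q] = setT by apply/seteqP; split.
  exact: measurableT.
have -> : [set _ : T | Q] = set0 by apply/seteqP; split.
exact: measurable0.
Qed.

Section NoiseMean.
Variables (R : realType) (N n K : nat) (P : 'M[R]_n) (pi : 'rV[R]_n) (gamma : R).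
Variables (Rw : 'I_N -> 'I_n -> 'I_n -> R) (Phi : 'M[R]_(n, K)).
Variables (W : nat -> 'M[R]_N) (X : set 'cV[R]_K) (thetastar : 'cV[R]_K).
Variable alpha : nat -> R.
Hypotheses (cX : convex_set (X : set (convex_lmodType 'cV[R]_K)))
  (kX : compact X) (Xstar : X thetastar).
Hypotheses (sP : stochastic P) (stP : stationary P pi).
Variables (d : measure_display) (T : measurableType d) (Pr : probability T R).
Variables (theta0 : 'I_N -> T -> 'cV[R]_K) (s s' : nat -> T -> 'I_n).
Hypothesis Xtheta0 : forall v w, X (theta0 v w).
Hypothesis model : sampling_model Pr P pi theta0 s s'.

Local Notation iter theta0 s s' := (td_iter gamma Rw Phi X W alpha theta0 s s').
Local Notation th k w := (iter (theta0 ^~ w) (s ^~ w) (s' ^~ w) k).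
Local Notation noise := (noise_term P pi gamma Rw Phi thetastar).

Let mtheta0 v l : measurable_fun setT (fun w => theta0 v w l 0).
Proof. by case: model. Qed.

Let ms k i j : measurable [set w | s k w = i /\ s' k w = j].
Proof. by case: model. Qed.

Lemma td_iter_bounded k v l : bounded_mfun (fun w => th k w v l 0).
Proof. exact: (td_iter_bounded_mfun _ _ _ _ _ cX kX Xstar mtheta0 ms Xtheta0). Qed.

Lemma noise_bounded k : bounded_mfun (fun w => noise (th k w) (s k w) (s' k w)).
Proof.
have b i j := bounded_mfun_noise P pi gamma Rw Phi thetastar (td_iter_bounded k) i j.
split.
  apply: (measurable_fun_sample ms k (F := fun i j w => noise (th k w) i j)) => i j.
  by case: (b i j).
have /fin_all_exists[M hM] : forall ij : 'I_n * 'I_n,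
    exists M : R, forall w, `|noise (th k w) ij.1 ij.2| <= M.
  by move=> ij; case: (b ij.1 ij.2).
exists (\sum_ij `|M ij|) => w; apply: le_trans (hM (s k w, s' k w) w) _.
rewrite (bigD1 (s k w, s' k w))//=; apply: le_trans (ler_norm _) _.
by rewrite lerDl sumr_ge0.
Qed.

Lemma noise_term_centered q :
  \sum_c pi 0 c.1 * P c.1 c.2 * noise q c.1 c.2 = 0.
Proof.
rewrite -(pair_big xpredT xpredT (fun i j => pi 0 i * P i j * noise q i j)) /=.
transitivity (N%:R^-1 * \sum_v dot (deviation thetastar q)
    (\sum_i \sum_j (pi 0 i * P i j) *: td_noise P pi gamma Rw Phi v (q v) i j)).
  rewrite mulr_sumr; under [RHS]eq_bigr do rewrite dot_sumr mulr_sumr.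
  rewrite [RHS]exchange_big; apply: eq_bigr => i _ /=.
  under [RHS]eq_bigr do rewrite dot_sumr mulr_sumr.
  rewrite [RHS]exchange_big; apply: eq_bigr => j _ /=.
  rewrite /noise_term mulrCA !mulr_sumr; apply: eq_bigr => v _.
  by rewrite dotZr.
rewrite big1 ?mulr0// => v _; rewrite td_noise_centered ?dot0r//.
Qed.

Let state := ('I_n * 'I_n)%type.
Let weight (c : state) : R := pi 0 c.1 * P c.1 c.2.

Let weight_ge0 c : 0 <= weight c.
Proof. by rewrite mulr_ge0//; [case: stP|exact: sP.1]. Qed.

Definition cylinder (h : nat -> 'I_n * 'I_n) k :=
  [set w | forall t, (t < k)%N -> s t w = (h t).1 /\ s' t w = (h t).2].

Lemma cylinderS h k : cylinder h k.+1 =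
  cylinder h k `&` [set w | s k w = (h k).1 /\ s' k w = (h k).2].
Proof.
apply/seteqP; split => w /=.
  by move=> hw; split; [move=> t tk; apply: hw; exact: ltnW|exact: hw].
move=> [hw hk] t; rewrite ltnS leq_eqVlt => /orP[/eqP -> //|]; exact: hw.
Qed.

Lemma measurable_cylinder h k : measurable (cylinder h k).
Proof.
elim: k => [|k IH]; last by rewrite cylinderS; exact: measurableI.
by rewrite (_ : cylinder h 0 = setT)//; apply/seteqP; split.
Qed.

(** The product rule of the sampling model, for the initial parameters and the
    samples before time [k]. *)
Lemma cylinder_independent h k (A : set T) : sigma_vectors theta0 A ->
  Pr (cylinder h k `&` A) = ((\prod_(t < k) weight (h t))%:E * Pr A)%E.
Proof.
move=> sA; have [_ _ law indep] := model.
pose F j := if j is j'.+1 then [set w | s j' w = (h j').1 /\ s' j' w = (h j').2] else A.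
have := indep (iota 0 k.+1) F (iota_uniq _ _).
move=> /(_ _)/= indepF; move: indepF.
rewrite (_ : \bigcap_(j in _) F j = cylinder h k `&` A); last first.
  apply/seteqP; split => w /=.
    move=> hw; split; last by apply: (hw 0%N); rewrite /= inE.
    move=> t tk; have := hw t.+1; rewrite /= in_cons mem_iota /= add1n !ltnS; apply.
    exact: tk.
  move=> [hw wA] [|j] //=; rewrite in_cons mem_iota /= add1n !ltnS => jk.
  exact: hw.
move=> ->; last first.
  move=> [|j] _ //; exists [set c | c = h j]; apply/seteqP; split => w /=.
    by move=> [-> ->]; case: (h j).
  by move=> <-.
rewrite big_cons /= muleC; congr (_ * _)%E.
rewrite -(big_mkord xpredT (fun t => weight (h t))) -[1%N]addn0 iotaDl big_map.
rewrite -{1}(subn0 k) -/(index_iota 0 k).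
elim/big_rec2 : _ => // j x y _ ->.
by rewrite /= law EFinM.
Qed.

Let TG := g_sigma_algebraType [set A | exists v l (Y : set R),
         measurable Y /\ A = [set w | Y (theta0 v w l 0)]].

Let sigma_measurable (A : set TG) : measurable A -> measurable (A : set T).
Proof.
suff : sigma_vectors theta0 `<=` @measurable _ T by apply.
apply: smallest_sub; first exact: sigma_algebra_measurable.
move=> _ [v [l [Y [mY ->]]]]; rewrite -[X in measurable X]setTI.
exact: mtheta0.
Qed.

Let mtheta0G v l : measurable_fun setT (fun w : TG => theta0 v w l 0).
Proof.
move=> _ Y mY; rewrite setTI; apply: sub_sigma_algebra.
by exists v, l, Y.
Qed.

(** Along the fixed history [h] the parameters are a function of the initial ones
    only, hence independent of the event that the samples follow [h]. *)
Lemma expect_cylinder_noise h k i j :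
  \int[Pr]_w (\1_(cylinder h k.+1) w
     * noise (iter (theta0 ^~ w) (fst \o h) (snd \o h) k) i j) =
  (\prod_(t < k.+1) weight (h t))
     * \int[Pr]_w noise (iter (theta0 ^~ w) (fst \o h) (snd \o h) k) i j.
Proof.
have bG v l : bounded_mfun (fun w : TG =>
    iter (theta0 ^~ w) (fst \o h) (snd \o h) k v l 0).
  apply: (td_iter_bounded_mfun _ _ _ _ _ cX kX Xstar (T := TG)
    (s := fun t _ => (h t).1) (s' := fun t _ => (h t).2)) => //.
  by move=> t a b; exact: measurable_set_cst.
have [mG [M hM]] := bounded_mfun_noise P pi gamma Rw Phi thetastar bG i j.
have toG (Y : set R) : measurable Y -> sigma_vectors theta0
    ((fun w => noise (iter (theta0 ^~ w) (fst \o h) (snd \o h) k) i j) @^-1` Y).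
  by move=> mY; rewrite -[X in sigma_vectors _ X]setTI; exact: mG.
apply: expect_independent.
- exact: measurable_cylinder.
- by apply: prodr_ge0 => t _.
- split; last by exists M.
  by move=> _ Y mY; rewrite setTI; apply: sigma_measurable; exact: toG.
- by move=> Y mY; apply: cylinder_independent; exact: toG.
Qed.

(** A history [H] of length [k] and the transition [c] at time [k] are encoded as
    a sequence on all times, so that [td_iter] applies to it. *)
Let extend k (H : {ffun 'I_k -> state}) (c : state) (t : nat) : state :=
  if insub t is Some i then H i else c.

Let extend_lt k H c (i : 'I_k) : extend H c i = H i.
Proof. by rewrite /extend valK. Qed.

Let extend_eq k (H : {ffun 'I_k -> state}) c : extend H c k = c.
Proof. by rewrite /extend insubF// ltnn. Qed.

(** Martingale property: conditionally on the past, the parameters are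
    determined and the noise is centered. *)
Lemma expect_noise k : \int[Pr]_w noise (th k w) (s k w) (s' k w) = 0.
Proof.
have [Z ZD] : exists Z : {ffun 'I_k -> state} -> state -> state -> T -> R,
    forall H c c', Z H c c' = fun w =>
      noise (iter (theta0 ^~ w) (fst \o extend H c) (snd \o extend H c) k) c'.1 c'.2.
  by eexists => H c c'.
have ZE H c c1 c' w : Z H c c' w = Z H c1 c' w.
  rewrite !ZD (_ : iter _ _ _ k =
    iter (theta0 ^~ w) (fst \o extend H c1) (snd \o extend H c1) k)//.
  apply: td_iter_ext => t tk /=.
  by rewrite -[t]/(nat_of_ord (Ordinal tk)) !extend_lt.
have bZ H c c' : bounded_mfun (Z H c c').
  rewrite ZD; apply: bounded_mfun_noise => v l.
  apply: (td_iter_bounded_mfun _ _ _ _ _ cX kX Xstar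
    (s := fun t _ => (extend H c t).1) (s' := fun t _ => (extend H c t).2)) => //.
  by move=> t a b; exact: measurable_set_cst.
have decomp w : noise (th k w) (s k w) (s' k w) =
    \sum_(H : {ffun 'I_k -> state}) \sum_c
      \1_(cylinder (extend H c) k.+1) w * Z H c c w.
  pose H0 := [ffun i : 'I_k => (s i w, s' i w)]; pose c0 := (s k w, s' k w).
  have inC : cylinder (extend H0 c0) k.+1 w.
    move=> t; rewrite ltnS leq_eqVlt => /orP[/eqP ->|tk]; first by rewrite extend_eq.
    by rewrite -[t]/(nat_of_ord (Ordinal tk)) extend_lt ffunE.
  have outC H c : cylinder (extend H c) k.+1 w -> H = H0 /\ c = c0.
    move=> hw; split.
      apply/ffunP => i; have := hw i (ltnW (ltn_ord i)).
      by rewrite extend_lt ffunE; case: (H i) => a b /= [-> ->].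
    by have := hw k (ltnSn k); rewrite extend_eq /c0; case: (c) => a b /= [-> ->].
  have only c : \1_(cylinder (extend H0 c) k.+1) w * Z H0 c c w
      = if c == c0 then Z H0 c0 c0 w else 0.
    have [->|nc] := eqVneq c c0; first by rewrite indicE mem_set// mul1r.
    rewrite indicE memNset ?mul0r// => hw.
    by move/eqP: nc; apply; case: (outC _ _ hw).
  have none H : H != H0 -> \sum_c \1_(cylinder (extend H c) k.+1) w * Z H c c w = 0.
    move=> /eqP nH; apply: big1 => c _; rewrite indicE memNset ?mul0r// => hw.
    by apply: nH; case: (outC _ _ hw).
  rewrite (big_only1 H0) => [|//|H nH _]; last exact: none.
  under eq_bigr do rewrite only.
  rewrite -big_mkcond big_pred1_eq ZD (_ : th k w =
    iter (theta0 ^~ w) (fst \o extend H0 c0) (snd \o extend H0 c0) k)//.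
  apply: td_iter_ext => t tk /=.
  by rewrite -[t]/(nat_of_ord (Ordinal tk)) extend_lt ffunE.
under eq_Rintegral do rewrite decomp.
have bC H c : bounded_mfun (fun w => \1_(cylinder (extend H c) k.+1) w * Z H c c w).
  apply: bounded_mfunM => //; apply: bounded_mfun_indic; exact: measurable_cylinder.
rewrite expect_sum; last by move=> H; exact: bounded_mfun_sum.
apply: big1 => H _; rewrite expect_sum//.
case: (pickP (xpredT : pred state)) => [c1 _|none]; last by rewrite big_pred0.
transitivity (\sum_c (\prod_(t < k) weight (H t)) * (weight c * \int[Pr]_w Z H c1 c w)).
  apply: eq_bigr => c _.
  have hp : \prod_(t < k) weight (extend H c t) = \prod_(t < k) weight (H t).
    by apply: eq_bigr => t _; rewrite extend_lt.
  have hz : \int[Pr]_w Z H c1 c w = \int[Pr]_w Z H c c w.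
    by apply: eq_Rintegral => w _; exact: ZE.
  have := expect_cylinder_noise (extend H c) k c.1 c.2.
  have -> : \prod_(t < k.+1) weight (extend H c t) =
      (\prod_(t < k) weight (H t)) * weight c.
    by rewrite big_ord_recr hp extend_eq.
  by rewrite -mulrA hz ZD.
rewrite -mulr_sumr (_ : \sum_c _ = 0) ?mulr0//.
transitivity (\int[Pr]_w (\sum_c weight c * Z H c1 c w)).
  rewrite expect_sum; last by move=> c; exact: bounded_mfunZ.
  by apply: eq_bigr => c _; rewrite expectZ.
rewrite -[RHS](expect_cst Pr 0); apply: eq_Rintegral => w _.
have -> : \sum_c weight c * Z H c1 c w = \sum_c pi 0 c.1 * P c.1 c.2 *
    noise (iter (theta0 ^~ w) (fst \o extend H c1) (snd \o extend H c1) k) c.1 c.2.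
  by apply: eq_bigr => c _; rewrite ZD.
exact: noise_term_centered.
Qed.

End NoiseMean.

(** * Expected value error *)

Section ExpectedBound.
Variables (d : measure_display) (T : measurableType d) (R : realType).
Variable Pr : probability T R.

Local Notation E f := (\int[Pr]_w f w).

Lemma expect_le_ae (f g : T -> R) : bounded_mfun f -> bounded_mfun g ->
  {ae Pr, forall w, f w <= g w} -> E f <= E g.
Proof.
move=> bf bg fg; have [[_ [M hM]] [_ [M' hM']]] := (bf, bg).
pose c := `|M| + `|M'|.
have bs (h : T -> R) : bounded_mfun h -> bounded_mfun (fun w => h w + c).
  by move=> bh; apply: bounded_mfunD => //; exact: bounded_mfun_cst.
have cf w : 0 <= f w + c.
  by have := hM w; have := ler_norm M; have := normr_ge0 M'; rewrite ler_norml /c; lra.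
have cg w : 0 <= g w + c.
  by have := hM' w; have := ler_norm M'; have := normr_ge0 M; rewrite ler_norml /c; lra.
have := expectation_le (bs _ bf).1 (bs _ bg).1 cf cg.
have fgc : {ae Pr, forall w, f w + c <= g w + c}.
  by apply: filterS fg => w; rewrite lerD2r.
move=> /(_ Pr fgc); rewrite (expectE Pr (bs _ bf)) (expectE Pr (bs _ bg)) lee_fin.
by rewrite !expectD ?lerD2r//; exact: bounded_mfun_cst.
Qed.

(** The weights [w] must not depend on the sample path: this is what allows the
    noises [m t] to disappear. *)
Lemma expect_affine_bound (F U Q : T -> R) (m : nat -> T -> R) (w : nat -> R)
    (c e x z : R) k :
  bounded_mfun F -> bounded_mfun U -> bounded_mfun Q ->
  (forall t, bounded_mfun (m t)) -> (forall t, E (m t) = 0) ->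
  {ae Pr, forall o, F o <= (U o + c * Q o + e) * x + z + \sum_(t < k) w t * m t o} ->
  ('E_Pr[F] <= ((fine 'E_Pr[U] + c * fine 'E_Pr[Q] + e) * x + z)%:E)%E.
Proof.
move=> bF bU bQ bm Em hae.
have bs : bounded_mfun (fun o => \sum_(t < k) w t * m t o).
  by apply: bounded_mfun_sum => t; exact: bounded_mfunZ.
have bA : bounded_mfun (fun o => x * U o + (x * c) * Q o).
  by apply: bounded_mfunD; exact: bounded_mfunZ.
have bB : bounded_mfun (fun o => x * U o + (x * c) * Q o + (e * x + z)).
  by apply: bounded_mfunD => //; exact: bounded_mfun_cst.
rewrite !expectE// lee_fin /=.
have -> : (E U + c * E Q + e) * x + z = \int[Pr]_o
    (x * U o + (x * c) * Q o + (e * x + z) + \sum_(t < k) w t * m t o).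
  rewrite expectD// expectD//; last exact: bounded_mfun_cst.
  rewrite expectD; [|exact: bounded_mfunZ|exact: bounded_mfunZ].
  rewrite !expectZ// expect_cst expect_sum; last by move=> t; exact: bounded_mfunZ.
  have -> : \sum_(t < k) \int[Pr]_o (w t * m t o) = 0.
    by apply: big1 => t _; rewrite expectZ// Em mulr0.
  ring.
apply: expect_le_ae => //; first exact: bounded_mfunD.
apply: filterS hae => o h; apply: le_trans h _.
by rewrite lerD2r le_eqVlt; apply/orP; left; apply/eqP; ring.
Qed.

End ExpectedBound.

Section Assembly.
Variables (R : realType) (N n K : nat) (P : 'M[R]_n) (pi : 'rV[R]_n) (gamma : R).
Variables (Rw : 'I_N -> 'I_n -> 'I_n -> R) (Phi : 'M[R]_(n, K)).
Variables (W : nat -> 'M[R]_N) (B : nat) (X : set 'cV[R]_K) (thetastar : 'cV[R]_K).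
Variables (alpha : nat -> R) (Lv : 'I_N -> R) (eta : R).
Hypothesis N0 : (0 < N)%N.
Hypothesis gamma01 : 0 < gamma < 1.
Hypotheses (cX : convex_set (X : set (convex_lmodType 'cV[R]_K)))
  (kX : compact X) (Xstar : X thetastar).
Hypotheses (sP : stochastic P) (stP : stationary P pi).
Hypothesis dW : forall k, doubly_stochastic (W k).
Hypothesis optimal : Amat P pi gamma Phi *m thetastar
  = N%:R^-1 *: \sum_v bvec P pi Rw Phi v.
Hypothesis Lv0 : forall v, 0 < Lv v.
Hypothesis eta0 : 0 <= eta.
Hypothesis mixing : forall k (M : 'M[R]_(N, K)),
  enorm (Wprod W k B *m Qmat R N *m M) <= eta * enorm (Qmat R N *m M).
Hypothesis alpha0 : forall k, 0 < alpha k.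

Local Notation R0 := (sup [set enorm (t - thetastar) | t in X]).
Local Notation smax := (sigma_max (Amat P pi gamma Phi)).

Lemma sample_path_bounds (theta0 : 'I_N -> 'cV[R]_K) (s s' : nat -> 'I_n) v :
  let th := td_iter gamma Rw Phi X W alpha theta0 s s' in
  let thhat := td_avg gamma Rw Phi X W alpha theta0 s s' in
  (forall v, X (theta0 v)) ->
  (forall v k, enorm (td_mean P pi gamma Rw Phi v (th k v))
    + enorm (td_noise P pi gamma Rw Phi v (th k v) (s k) (s' k)) <= Lv v) ->
  path_bounds B N%:R (\sum_v Lv v) (smax * R0) (1 - gamma) eta alpha
    (fun t => enorm (deviation thetastar (th t)))
    (fun t => drift P pi gamma Phi thetastar (th t))
    (fun t => disagreement (th t))
    (fun t => noise_term P pi gamma Rw Phi thetastar (th t) (s t) (s' t))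
    (fun t => value_error pi Phi thetastar (th t v))
    (fun k => value_error pi Phi thetastar (thhat k v))
    (enorm (stack theta0)).
Proof.
move=> th thhat Xth0 step.
split.
- by move=> t; exact: enorm_ge0.
- by move=> t; exact: enorm_ge0.
- exact: enorm_Qmat.
- by move=> t; rewrite !enorm_sqr; apply: deviation_recursion.
- move=> t /=; apply: (value_error_le Phi N0 cX kX Xstar sP stP gamma01) => u.
  exact: (td_iter_in _ _ _ _ _ kX Xstar).
- by move=> t; apply: (disagreement_le N0 cX kX Xstar dW alpha0 Xth0 step eta0 mixing).
- by move=> t; apply: drift_le.
- by move=> t; apply: (deviation_le cX kX Xstar dW alpha0 Xth0 step).
- move=> k; rewrite -td_weight_sum.
  exact: (td_avg_convex gamma Rw Phi W X thetastar alpha0 theta0 s s' stP).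
- by congr value_error; exact: (td_avg1 _ _ _ _ _ alpha0).
Qed.

Variables (d : measure_display) (T : measurableType d) (Pr : probability T R).
Variables (theta0 : 'I_N -> T -> 'cV[R]_K) (s s' : nat -> T -> 'I_n).
Hypothesis Xtheta0 : forall v w, X (theta0 v w).
Hypothesis model : sampling_model Pr P pi theta0 s s'.

Local Notation th k w :=
  (td_iter gamma Rw Phi X W alpha (theta0 ^~ w) (s ^~ w) (s' ^~ w) k).
Local Notation thhat k w :=
  (td_avg gamma Rw Phi X W alpha (theta0 ^~ w) (s ^~ w) (s' ^~ w) k).

Lemma td_avg_bounded k v l : bounded_mfun (fun w => thhat k w v l 0).
Proof.
elim: k v l => [|k IH] v l.
  exact: (td_iter_bounded gamma Rw Phi W alpha cX kX Xstar Xtheta0 model 0).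
rewrite /=; under eq_fun do rewrite !mxE.
apply: bounded_mfunZ; apply: bounded_mfunD; apply: bounded_mfunZ; first exact: IH.
exact: (td_iter_bounded gamma Rw Phi W alpha cX kX Xstar Xtheta0 model).
Qed.

Lemma value_error_bounded k v :
  bounded_mfun (fun w => value_error pi Phi thetastar (thhat k w v)).
Proof.
under eq_fun do rewrite /value_error sqnormDE JtildeB.
apply: bounded_mfun_sum => i; apply: bounded_mfunZ.
have b : bounded_mfun (fun w => Jtilde Phi (thhat k w v - thetastar) i 0).
  apply: bounded_mfun_mulmx => j; under eq_fun do rewrite !mxE.
  by apply: bounded_mfunB; [exact: td_avg_bounded|exact: bounded_mfun_cst].
exact: bounded_mfunM.
Qed.

Hypothesis bounded_steps : forall v k, {ae Pr, forall w,
  enorm (td_mean P pi gamma Rw Phi v (th k w v))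
  + enorm (td_noise P pi gamma Rw Phi v (th k w v) (s k w) (s' k w)) <= Lv v}.

(** Almost every sample path satisfies the pathwise inequalities, and the noise
    integrates to zero. *)
Lemma expected_rate v k (c e x z : R) (w : nat -> R) :
  (forall u a q m f F Q0,
    path_bounds B N%:R (\sum_v Lv v) (smax * R0) (1 - gamma) eta alpha u a q m f F Q0 ->
    F k <= (u 0%N ^+ 2 + c * Q0 + e) * x + z + \sum_(t < k.+1) w t * m t) ->
  ('E_Pr[fun o => value_error pi Phi thetastar (thhat k o v)] <=
    ((fine 'E_Pr[fun o => enorm (deviation thetastar (th 0%N o)) ^+ 2]
      + c * fine 'E_Pr[fun o => enorm (stack (th 0%N o))] + e) * x + z)%:E)%E.
Proof.
move=> rate.
have bth := td_iter_bounded gamma Rw Phi W alpha cX kX Xstar Xtheta0 model.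
have bdev t : bounded_mfun (fun o => enorm (deviation thetastar (th t o))).
  by apply: bounded_mfun_enorm => i j; apply: bounded_mfun_deviation => u l; exact: bth.
apply: (expect_affine_bound (w := w) (k := k.+1)
  (m := fun t o => noise_term P pi gamma Rw Phi thetastar (th t o) (s t o) (s' t o))).
- exact: value_error_bounded.
- by under eq_fun do rewrite expr2; exact: bounded_mfunM.
- apply: bounded_mfun_enorm => i j; under eq_fun do rewrite mxE.
  exact: (bth 0%N).
- by move=> t; apply: (noise_bounded gamma Rw Phi W alpha cX kX Xstar Xtheta0 model).
- by move=> t; apply: (expect_noise gamma Rw Phi W alpha cX kX Xstar sP stP Xtheta0 model).
have all_steps : {ae Pr, forall w, forall u t,
    enorm (td_mean P pi gamma Rw Phi u (th t w u))
    + enorm (td_noise P pi gamma Rw Phi u (th t w u) (s t w) (s' t w)) <= Lv u}.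
  by apply: filter_forall => u; apply: ae_foralln => t; exact: bounded_steps.
apply: filterS all_steps => o step.
exact: (rate _ _ _ _ _ _ _ (sample_path_bounds v (fun u => Xtheta0 u o) step)).
Qed.

End Assembly.

Theorem theorem1 (R : realType) (N n K : nat)
  (P : 'M[R]_n) (pi : 'rV[R]_n) (gamma : R)
  (Rw : 'I_N -> 'I_n -> 'I_n -> R) (C : 'I_N -> R) (Phi : 'M[R]_(n, K))
  (E : nat -> rel 'I_N) (W : nat -> 'M[R]_N) (B : nat) (beta : R)
  (X : set 'cV[R]_K) (thetastar : 'cV[R]_K)
  (d : measure_display) (T : measurableType d) (Pr : probability T R)
  (theta0 : 'I_N -> T -> 'cV[R]_K) (s s' : nat -> T -> 'I_n)
  (alpha : nat -> R) (Lv : 'I_N -> R) :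
  (0 < N)%N ->
  0 < gamma < 1 ->
  (forall k, undirected (E k)) ->
  (0 < B)%N -> union_connected E B ->
  0 < beta -> (forall k, admissible_weights (E k) beta (W k)) ->
  stochastic P -> irreducible P -> stationary P pi ->
  (forall v i j, `|Rw v i j| <= C v) ->
  \rank Phi = K -> (forall i, enorm (phi Phi i) <= 1) ->
  projected_bellman_solution P pi gamma Rw Phi thetastar ->
  convex_set (X : set (convex_lmodType 'cV[R]_K)) -> compact X ->
  X thetastar ->
  (forall v w, X (theta0 v w)) ->
  sampling_model Pr P pi theta0 s s' ->
  0 < mixing_rate W < 1 ->
  (forall k (Th : 'M[R]_(N, K)),
     enorm (Wprod W k B *m Qmat R N *m Th) <= mixing_rate W * enorm (Qmat R N *m Th)) ->
  let theta k w :=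
    td_iter gamma Rw Phi X W alpha (theta0 ^~ w) (s ^~ w) (s' ^~ w) k in
  let thetahat k w :=
    td_avg gamma Rw Phi X W alpha (theta0 ^~ w) (s ^~ w) (s' ^~ w) k in
  (forall v, 0 < Lv v) ->
  (forall v k, {ae Pr, forall w,
     enorm (td_mean P pi gamma Rw Phi v (theta k w v))
     + enorm (td_noise P pi gamma Rw Phi v (theta k w v) (s k w) (s' k w))
     <= Lv v}) ->
  let L := \sum_v Lv v in
  let smax := sigma_max (Amat P pi gamma Phi) in
  let R0 := sup [set enorm (th - thetastar) | th in X] in
  let delta := mixing_rate W `^ B%:R^-1 in
  let beta0 :=
    fine ('E_Pr[fun w => (enorm (mean_vec (theta 0%N w) - thetastar) ^+ 2)%R])%E
    + alpha 0%N * fine ('E_Pr[fun w => (enorm (stack (theta 0%N w)))%R])%E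
        * (L + 2 * N%:R * smax * R0) / (N%:R * mixing_rate W * (1 - delta)) in
  let beta1 :=
    4 * L * (L + N%:R * smax * R0) / (N%:R * mixing_rate W * (1 - delta)) in
  let err v k :=
    ('E_Pr[fun w => (sqnormD pi (Jtilde Phi (thetahat k w v)
                                 - Jtilde Phi thetastar))%R])%E in
  (forall a : R, 0 < a -> (forall k, alpha k = a) ->
     forall v k,
       (err v k <= (beta0 / (a * (1 - gamma)) * (k.+1)%:R^-1
                    + beta1 * a / (1 - gamma))%:E)%E)
  /\
  ((forall k, alpha k = (Num.sqrt (k.+1)%:R)^-1) ->
     forall v k,
       (err v k <= ((beta0 + beta1 * (1 + ln (k.+1)%:R))
                    / (2 * (1 - gamma) * Num.sqrt (k.+1)%:R))%:E)%E).
Proof.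
move=> N0 gamma01 _ B0 _ _ adm sP irrP stP _ rkPhi _ pb cX kX Xstar Xth0 model
  eta01 mixing theta thetahat Lv0 steps L smax R0 delta beta0 beta1 err.
have dW k : doubly_stochastic (W k) by case: (adm k).
have optimal := projected_bellman_normal_eq sP stP irrP rkPhi N0 pb.
have eta0 : 0 <= mixing_rate W by rewrite ltW//; case/andP: eta01.
have L0 : 0 <= L by apply: sumr_ge0 => v _; exact: ltW.
have c00 : 0 <= smax * R0.
  by rewrite mulr_ge0 ?sigma_max_ge0//; exact: (radius_ge0 kX Xstar).
have g0 : 0 < 1 - gamma by rewrite subr_gt0; case/andP: gamma01.
have N1 : 1 <= N%:R :> R by rewrite ler1n.
pose cq := (L + 2 * N%:R * (smax * R0)) / (N%:R * mixing_rate W * (1 - delta)).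
have cqE : (L + 2 * N%:R * smax * R0) / (N%:R * mixing_rate W * (1 - delta)) = cq.
  by rewrite /cq !mulrA.
have beta1E : 4 * L * (L + N%:R * (smax * R0)) / (N%:R * mixing_rate W * (1 - delta)) = beta1.
  by rewrite /beta1 !mulrA.
have rate al := @expected_rate R N n K P pi gamma Rw Phi W B X thetastar al Lv
  (mixing_rate W) N0 gamma01 cX kX Xstar sP stP dW optimal Lv0 eta0 mixing.
split.
- move=> a a0 ha v k.
  have alphaE : alpha = (fun=> a) by apply/funext.
  subst alpha.
  have [w hw] := constant_step_rate B0 N1 L0 c00 g0 eta01 k a0.
  apply: le_trans (rate _ (fun=> a0) d T Pr theta0 s s' Xth0 model steps v k (a * cq) 0
    ((a * (1 - gamma))^-1 * k.+1%:R^-1) (beta1 * a / (1 - gamma)) w _) _.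
    move=> u q1 q2 m f F Q0 pbs; apply: le_trans (hw _ _ _ _ _ _ _ pbs) _.
    by rewrite lerD2r -/delta -/cq beta1E lerD2r addr0 (mulrAC a cq) -[leLHS]mulrA.
  rewrite lee_fin addr0 /beta0 -[X in _ <= (_ + X) / _ / _ + _]mulrA cqE (mulrAC a cq).
  by rewrite -[X in _ <= X + _]mulrA.
- move=> ha v k.
  have alphaE : alpha = (fun t => (Num.sqrt t.+1%:R)^-1) by apply/funext.
  subst alpha.
  have al0 t : 0 < (Num.sqrt t.+1%:R)^-1 :> R by rewrite invr_gt0 sqrtr_gt0.
  have [w hw] := inverse_sqrt_step_rate B0 N1 L0 c00 g0 eta01 k.
  apply: le_trans (rate _ al0 d T Pr theta0 s s' Xth0 model steps v k cq
    (beta1 * (1 + ln k.+1%:R)) (2 * (1 - gamma) * Num.sqrt k.+1%:R)^-1 0 w _) _.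
    move=> u q1 q2 m f F Q0 pbs; apply: le_trans (hw _ _ _ _ _ _ _ pbs) _.
    by rewrite lerD2r -/delta beta1E addr0 [Q0 * _]mulrC.
  rewrite lee_fin addr0 /beta0 sqrtr1 invr1 mul1r.
  by rewrite -[X in _ <= (_ + X + _) / _]mulrA cqE [cq * _]mulrC.
Qed.
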